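(* For any $(m,n,p)\in\mathbb R^3\setminus\{0\}$ and any $0\ne k\in\mathbb C$, the solution $(V_+,0,\eta)$ of the Killing spinor equations (with zero divergence) on the quadratic Lie algebra $\mathfrak g_{m,n,p}$ described in the context, with associated subspaces $l=V_+^{1,0}$, $\overline l=V_+^{0,1}$ of $\mathfrak g_{m,n,p}^{\mathbb C}=\mathfrak g_{m,n,p}\otimes_{\mathbb R}\mathbb C$, induces an embedding of the $N=2$ superconformal vertex algebra of central charge $c=9$ into the universal superaffine vertex algebra $V^k((\mathfrak g^{\mathbb C}_{m,n,p})_{\rm super})$ with level $k$. The generators of the $N=2$ superconformal vertex algebra are $$J_0=\frac ik:e^je_j:,$$ $$H'=\frac1k\big(:e_j(Se^j):+:e^j(Se_j):\big)+\frac1{k^2}\big(:e_j:e^r[e^j,e_r]::+:e^j:e_r[e_j,e^r]::-:e_j:e_r[e^j,e^r]::-:e^j:e^r[e_j,e_r]::\big)+\frac1kTw.$$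
   Context: The Lie algebra. $\mathfrak h_{\mathbb C}$ is the Lie algebra of the complex Heisenberg group, as a real 6-dimensional Lie algebra with basis $v_1,\dots,v_6$ and dual basis $v^1,\dots,v^6$ satisfying $dv^1=dv^2=dv^3=dv^4=0$, $dv^5=v^{13}-v^{24}$, $dv^6=v^{14}+v^{23}$ (with $v^{ij}=v^i\wedge v^j$ and $d\beta(v,w)=-\beta([v,w])$), and complex structure $Iv_1=v_2$, $Iv_3=v_4$, $Iv_5=v_6$. Put $d^c\omega=v^{135}+v^{236}+v^{146}-v^{245}$, $F=2\pi i\big(m(v^{34}-v^{12})+n(v^{23}-v^{14})+p(v^{13}+v^{24})\big)$, $\alpha=(2\pi^2(m^2+n^2+p^2))^{-1}$. $\mathfrak g_{m,n,p}=\mathfrak h_{\mathbb C}\oplus i\mathbb R\oplus\mathfrak h_{\mathbb C}^*$ has pairing $(v+r+\beta|v+r+\beta)=\beta(v)-\alpha r^2$ and bracket $[v+r+\beta,w+t+\eta]=[v,w]-\eta([v,\cdot])+\beta([w,\cdot])-i_wi_v(d^c\omega)-F(v,w)+2\alpha(r\,i_wF-t\,i_vF)$. Let $g=\sum_{i=1}^6v^i\otimes v^i$, $V_+=\{v+g(v):v\in\mathfrak h_{\mathbb C}\}$ with $V_-=V_+^\perp=\{v+r-g(v)\}$; $I$ is transported to $V_+\cong\mathfrak h_{\mathbb C}$ by $v+g(v)\mapsto Iv+g(Iv)$, and $V_+^{1,0},V_+^{0,1}\subset V_+\otimes\mathbb C$ are its $\pm i$-eigenspaces; $\eta$ is a pure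 spinor for $V_+$ whose line corresponds to $I$ (annihilated by $V_+^{1,0}$). SUSY vertex algebras are $N_K=1$ SUSY vertex algebras in the sense of Heluani--Kac: superspaces over $\mathbb C$ with odd endomorphism $S$, $T=S^2$, vacuum, normally ordered product $:ab:$ and $\Lambda$-bracket $[a_\Lambda b]$ polynomial in $\Lambda=(\lambda,\chi)$, $\lambda$ even, $\chi$ odd, $\chi^2=-\lambda$, $S\lambda=\lambda S$, $S\chi+\chi S=2\lambda$, satisfying $[Sa_\Lambda b]=\chi[a_\Lambda b]$, $[a_\Lambda Sb]=-(-1)^{|a|}(S+\chi)[a_\Lambda b]$, skew-symmetry $[a_\Lambda b]=(-1)^{|a||b|}[b_{-\Lambda-\nabla}a]$ ($\nabla=(T,S)$), Jacobi $[a_\Lambda[b_\Gamma c]]=(-1)^{|a|+1}[[a_\Lambda b]_{\Lambda+\Gamma}c]+(-1)^{(|a|+1)(|b|+1)}[b_\Gamma[a_\Lambda c]]$, quasicommutativity $:ab:-(-1)^{|a||b|}:ba:=\int_{-\nabla}^0d\Lambda[a_\Lambda b]$, quasiassociativity, and the non-commutative Wick formula $[a_\Lambda:bc:]=:[a_\Lambda b]c:+(-1)^{(|a|+1)|b|}:b[a_\Lambda c]:+\int_0^\Lambda d\Gamma[[a_\Lambda b]_\Gamma c]$ (where $\int d\Lambda$ means $\int d\lambda\,\partial_\chi$). $:a:bc::$ means $:a(:bc:):$. $V^k(\mathfrak g_{\rm super})$ is the universal enveloping SUSY vertex algebra generated by the odd copy $\Pi\mathfrak g$ with $[a_\Lambda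 b]=[a,b]+\chi k(a|b)$. Notation. $\epsilon_j,\overline\epsilon_j$ ($j=1,2,3$) are bases of $l,\overline l$ with $(\epsilon_j|\overline\epsilon_r)=\delta_{jr}$; $e_j=\Pi\epsilon_j$, $e^j=\Pi\overline\epsilon_j$; repeated indices are summed; $w=[e^j,e_j]_l-[e^j,e_j]_{\overline l}$, subscripts denoting orthogonal projection in $\mathfrak g^{\mathbb C}_{m,n,p}=l\oplus\overline l\oplus V_-^{\mathbb C}$. $J$ (even), $H$ (odd) induce an embedding of the $N=2$ superconformal vertex algebra of central charge $c$ if $[J_\Lambda J]=-(H+\tfrac{\lambda\chi}3c)$, $[H_\Lambda J]=(2T+2\lambda+\chi S)J$, $[H_\Lambda H]=(2T+\chi S+3\lambda)H+\tfrac{\chi\lambda^2}3c$ (so that there is a morphism of SUSY vertex algebras from the one generated by $J,H$ with these relations). *)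

(* Defs.v *)
From HB Require Import structures.
From mathcomp Require Import all_boot all_order all_algebra.
From mathcomp Require Import complex.
From mathcomp Require Import boolp classical_sets functions fsbigop reals trigo.

Set Implicit Arguments.
Unset Strict Implicit.
Unset Printing Implicit Defensive.

Import Order.TTheory GRing.Theory Num.Theory.

Local Open Scope classical_set_scope.
Local Open Scope ring_scope.

(* An element of C[Lambda] (x) W is encoded by its coefficients in the basis
   lambda^n chi^q (n : nat, q : bool), written to the left of W, where
   chi^2 = - lambda. Finiteness of the support is not part of the type; it is
   an axiom on the Lambda-brackets. *)

Notation lpoly W := (nat -> bool -> W).

Section LambdaPolynomials.
Variable K : numFieldType.

Definition pconst (W : lmodType K) (w : W) : lpoly W :=
  fun n q => if (n == 0%N) && ~~ q then w else 0.

Definition lamM (W : lmodType K) (P : lpoly W) : lpoly W :=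
  fun n q => if n is n'.+1 then P n' q else 0.

(* chi (lambda^n) = lambda^n chi and chi (lambda^n chi) = - lambda^(n+1). *)
Definition chiM (W : lmodType K) (P : lpoly W) : lpoly W :=
  fun n q => if q then P n false else - lamM P n true.

(* An even (resp. odd) operator on the coefficients commutes
   (resp. anticommutes) with chi. *)
Definition evenM (W : lmodType K) (f : W -> W) (P : lpoly W) : lpoly W :=
  fun n q => f (P n q).
Definition oddM (W : lmodType K) (f : W -> W) (P : lpoly W) : lpoly W :=
  fun n q => (-1) ^+ q *: f (P n q).

(* The action of S on C[Lambda] (x) W: S lambda = lambda S and
   S chi = 2 lambda - chi S. *)
Definition opS (W : lmodType K) (S : W -> W) (P : lpoly W) : lpoly W :=
  fun n q => oddM S P n q + (if q then 0 else 2 *: lamM P n true).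
Definition opT (W : lmodType K) (S : W -> W) (P : lpoly W) : lpoly W :=
  opS S (opS S P).

(* The sum over n is that of the finitely many nonzero terms. *)
Definition lsum (W : lmodType K) (F : lpoly W) : W :=
  \sum_(n \in [set: nat]) (F n false + F n true).

End LambdaPolynomials.

Section Brackets.
Variables (K : numFieldType) (V : lmodType K).
Variables (S : V -> V) (nop : V -> V -> V) (br : V -> V -> lpoly V).

(* [b_{-Lambda-nabla} a] *)
Definition br_skew (b a : V) : lpoly V :=
  lsum (fun n q =>
    iter n (fun P => - lamM P - opT S P)
      (iter q (fun P => - chiM P - opS S P) (pconst (br b a n q)))).

(* In C[Lambda] (x) C[Gamma] (x) V, encoded as [lpoly (lpoly V)] with Lambda
   outside and Gamma = (gamma, eta) inside, chi and eta anticommute. The bracket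
   is odd: moving an odd variable to the left across "[" costs a sign, and
   moving it across "[a_Lambda" costs (-1)^(|a|+1). *)

(* [a_Lambda [b_Gamma c]], with pa the parity of a *)
Definition br_br_r (pa : bool) (a b c : V) : lpoly (lpoly V) :=
  fun n q m r =>
    (-1) ^+ (r && (~~ pa (+) q)) *: br a (br b c m r) n q.

(* [b_Gamma [a_Lambda c]], with pb the parity of b *)
Definition br_br_r' (pb : bool) (a b c : V) : lpoly (lpoly V) :=
  fun n q m r => (-1) ^+ (q && ~~ pb) *: br b (br a c n q) m r.

(* [u_{Lambda+Gamma} c] *)
Definition br_add (u c : V) : lpoly (lpoly V) :=
  lsum (fun n q =>
    iter n (fun P => lamM P + evenM (@lamM K V) P)
      (iter q (fun P => chiM P + oddM (@chiM K V) P)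
        (pconst (pconst (br u c n q))))).

(* [[a_Lambda b]_{Lambda+Gamma} c] *)
Definition br_br_l (a b c : V) : lpoly (lpoly V) :=
  lsum (fun n q =>
    (-1) ^+ q *: iter n (@lamM K _) (iter q (@chiM K _)
      (br_add (br a b n q) c))).

(* int_{-nabla}^0 dLambda P = int_{-T}^0 dlambda (partial_chi P) *)
Definition int_nabla (P : lpoly V) : V :=
  \sum_(n \in [set: nat])
    ((-1) ^+ n / n.+1%:R) *: iter n.+1 (S \o S) (P n true).

(* :(int_0^nabla dLambda a) P: *)
Definition nop_int (a : V) (P : lpoly V) : V :=
  \sum_(n \in [set: nat])
    n.+1%:R^-1 *: nop (iter n.+1 (S \o S) a) (P n true).

(* int_0^Lambda dGamma [[a_Lambda b]_Gamma c] ; the two signs produced by moving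
   chi^q out of the bracket and across partial_eta cancel. *)
Definition br_int (a b c : V) : lpoly V :=
  fun n q =>
    \sum_(m < n) m.+1%:R^-1 *: br (br a b (n - m.+1)%N q) c m true.

End Brackets.

Record susyVA (K : numFieldType) := SusyVA {
  va_car :> lmodType K;
  (* [homog false] (resp. [homog true]): the even (resp. odd) subspace *)
  homog : bool -> set va_car;
  opSV : va_car -> va_car;
  vac : va_car;
  nop : va_car -> va_car -> va_car;
  br : va_car -> va_car -> lpoly va_car;

  homog0 : forall pa, homog pa 0;
  homogZD : forall pa (c : K) a b,
    homog pa a -> homog pa b -> homog pa (c *: a + b);
  homog_sum : forall a, exists a0 a1,
    [/\ homog false a0, homog true a1 & a = a0 + a1];
  homog_disj : forall a, homog false a -> homog true a -> a = 0;

  opSV_lin : linear opSV;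
  nop_linl : forall b, linear (nop ^~ b);
  nop_linr : forall a, linear (nop a);
  br_linl : forall b, linear (br ^~ b);
  br_linr : forall a, linear (br a);
  br_fin : forall a b, exists N, forall n q, (N <= n)%N -> br a b n q = 0;

  vac_even : homog false vac;
  opSV_odd : forall pa a, homog pa a -> homog (~~ pa) (opSV a);
  nop_even : forall pa pb a b,
    homog pa a -> homog pb b -> homog (pa (+) pb) (nop a b);
  br_odd : forall pa pb a b n q,
    homog pa a -> homog pb b -> homog (~~ (pa (+) pb) (+) q) (br a b n q);

  br_Sl : forall a b, br (opSV a) b = chiM (br a b);
  br_Sr : forall pa a b, homog pa a ->
    br a (opSV b) = - ((-1) ^+ pa *: (opS opSV (br a b) + chiM (br a b)));
  br_skewsym : forall pa pb a b, homog pa a -> homog pb b ->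
    br a b = (-1) ^+ (pa && pb) *: br_skew opSV br b a;
  br_jacobi : forall pa pb a b c, homog pa a -> homog pb b ->
    br_br_r br pa a b c =
      (-1) ^+ (~~ pa) *: br_br_l br a b c
      + (-1) ^+ (~~ pa && ~~ pb) *: br_br_r' br pb a b c;

  nop_vacl : forall a, nop vac a = a;
  nop_vacr : forall a, nop a vac = a;
  nop_S : forall pa a b, homog pa a ->
    opSV (nop a b) = nop (opSV a) b + (-1) ^+ pa *: nop a (opSV b);
  nop_quasicomm : forall pa pb a b, homog pa a -> homog pb b ->
    nop a b - (-1) ^+ (pa && pb) *: nop b a = int_nabla opSV (br a b);
  nop_quasiassoc : forall pa pb a b c, homog pa a -> homog pb b ->
    nop (nop a b) c - nop a (nop b c) =
      nop_int opSV nop a (br b c)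
      + (-1) ^+ (pa && pb) *: nop_int opSV nop b (br a c);

  (* The sign (-1)^(q |b|) comes from :b (chi^q x): = (-1)^(q |b|) chi^q :b x: *)
  br_wick : forall pa pb a b c, homog pa a -> homog pb b ->
    br a (nop b c) =
      (fun n q => nop (br a b n q) c)
      + (-1) ^+ (~~ pa && pb) *:
          (fun n q => (-1) ^+ (q && pb) *: nop b (br a c n q))
      + br_int br a b c
}.

Arguments vac {K} s.
Arguments homog {K s} _ _.
Arguments opSV {K s} _.
Arguments nop {K s} _ _.
Arguments br {K s} _ _ _ _.

Definition opTV (K : numFieldType) (V : susyVA K) (a : V) : V := opSV (opSV a).

Record susy_morphism (K : numFieldType) (V W : susyVA K) (f : V -> W) : Prop :=
  SusyMorphism {
    mor_lin : linear f;
    mor_homog : forall pa a, homog pa a -> homog pa (f a);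
    mor_vac : f (vac V) = vac W;
    mor_S : forall a, f (opSV a) = opSV (f a);
    mor_nop : forall a b, f (nop a b) = nop (f a) (f b);
    mor_br : forall a b n q, f (br a b n q) = br (f a) (f b) n q
  }.

Section Superaffine.
Variables (K : numFieldType) (g : lmodType K).
Variables (brk : g -> g -> g) (form : g -> g -> K) (k : K).

(* [Pi x] is the image in V of the copy of x in the parity-reversed space. *)
Definition superaffine_map (V : susyVA K) (Pi : g -> V) : Prop :=
  [/\ linear Pi, forall x, homog true (Pi x) &
      forall x y, br (Pi x) (Pi y) =
        pconst (Pi (brk x y)) + chiM (pconst ((k * form x y) *: vac V))].

(* (V, Pi) is the universal enveloping SUSY vertex algebra V^k(g_super); it is
   determined up to a unique isomorphism by this universal property. *)
Definition universal_superaffine (V : susyVA K) (Pi : g -> V) : Prop :=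
  superaffine_map Pi /\
  forall (W : susyVA K) (Pi' : g -> W), superaffine_map Pi' ->
    exists! f : V -> W, susy_morphism f /\ forall x, f (Pi x) = Pi' x.

End Superaffine.

Section N2.
Variables (K : numFieldType) (c : K).

Definition N2_relations (V : susyVA K) (J H : V) : Prop :=
  [/\ br J J = - (pconst H + (c / 3) *: lamM (chiM (pconst (vac V)))),
      br H J = pconst (2 *: opTV J) + 2 *: lamM (pconst J)
               + chiM (pconst (opSV J)) &
      br H H = pconst (2 *: opTV H) + chiM (pconst (opSV H))
               + 3 *: lamM (pconst H)
               + (c / 3) *: chiM (lamM (lamM (pconst (vac V))))].

Definition N2_pair (V : susyVA K) (J H : V) : Prop :=
  [/\ homog false J, homog true H & N2_relations J H].

Definition N2_superconformal (N : susyVA K) (J H : N) : Prop :=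
  N2_pair J H /\
  forall (W : susyVA K) (J' H' : W), N2_pair J' H' ->
    exists! f : N -> W, [/\ susy_morphism f, f J = J' & f H = H'].

(* J and H satisfy the N = 2 relations, so that the universal SUSY vertex algebra
   with these relations maps to V. *)
Definition induces_N2_embedding (V : susyVA K) (J H : V) : Prop :=
  N2_pair J H /\
  forall (N : susyVA K) (JN HN : N), N2_superconformal JN HN ->
    exists! f : N -> V, [/\ susy_morphism f, f JN = J & f HN = H].

End N2.

(* The complexification U (x)_R C: a pair (x, y) stands for x (x) 1 + y (x) i. *)

Definition cplx (R : rcfType) (U : lmodType R) : Type := (U * U)%type.

HB.instance Definition _ (R : rcfType) (U : lmodType R) :=
  GRing.Zmodule.copy (cplx U) (U * U)%type.

Section Complexification.
Variables (R : rcfType) (U : lmodType R).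

Definition cplx_scale (z : R[i]) (u : cplx U) : cplx U :=
  (complex.Re z *: (u.1 : U) - complex.Im z *: (u.2 : U),
   complex.Re z *: (u.2 : U) + complex.Im z *: (u.1 : U)).

Fact cplx_scaleA a b u :
  cplx_scale a (cplx_scale b u) = cplx_scale (a * b) u.
Proof.
case: a b u => [a a'] [b b'] [x y]; congr (_, _) => /=;
  rewrite !scalerBr !scalerDr !scalerA ?scalerDl ?scalerBl.
- by rewrite scaleNr [(a' * b) *: y + _]addrC !opprD addrACA.
- by rewrite scaleNr [(a' * b) *: x - _]addrC addrACA.
Qed.

Fact cplx_scale1 : left_id 1 cplx_scale.
Proof. by case=> x y; congr (_, _); rewrite /= !scale1r scale0r ?subr0 ?addr0. Qed.

Fact cplx_scaleDr : right_distributive cplx_scale +%R.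
Proof.
case=> a a' [x y] [x' y']; congr (_, _); rewrite /= !scalerDr ?opprD //.
- exact: addrACA.
- exact: addrACA.
Qed.

Fact cplx_scaleDl u : {morph cplx_scale^~ u : a b / a + b}.
Proof.
case: u => x y [a a'] [b b']; congr (_, _); rewrite /= !scalerDl ?opprD //.
- exact: addrACA.
- exact: addrACA.
Qed.

HB.instance Definition _ := GRing.Zmodule_isLmodule.Build R[i] (cplx U)
  cplx_scaleA cplx_scale1 cplx_scaleDr cplx_scaleDl.

Definition cplx_set (A : set U) : set (cplx U) :=
  [set u | A u.1 /\ A u.2].
Definition cplx_map (f : U -> U) (u : cplx U) : cplx U := (f u.1, f u.2).
Definition cplx_brk (f : U -> U -> U) (u w : cplx U) : cplx U :=
  (f u.1 w.1 - f u.2 w.2, f u.1 w.2 + f u.2 w.1).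
Definition cplx_form (f : U -> U -> R) (u w : cplx U) : R[i] :=
  Complex (f u.1 w.1 - f u.2 w.2) (f u.1 w.2 + f u.2 w.1).

End Complexification.

Section HeisenbergForms.
Variable R : realType.
Implicit Types u v w z : 'rV[R]_6.

(* v^i(v), with the indices i running from 1 to 6 *)
Definition dual (i : nat) v : R := v 0 (inord i.-1).
(* v^{ij} and v^{ijk} *)
Definition dual2 (i j : nat) v w : R := dual i v * dual j w - dual j v * dual i w.
Definition dual3 (i j k : nat) u v w : R :=
  dual i u * dual2 j k v w - dual j u * dual2 i k v w + dual k u * dual2 i j v w.

(* (d v^5)(v, w), (d v^6)(v, w) *)
Definition d5 v w : R := dual2 1 3 v w - dual2 2 4 v w.
Definition d6 v w : R := dual2 1 4 v w + dual2 2 3 v w.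

(* The bracket of h_C, from d beta (v, w) = - beta [v, w]. *)
Definition hbr v w : 'rV[R]_6 :=
  - (d5 v w *: delta_mx 0 (inord 4) + d6 v w *: delta_mx 0 (inord 5)).

(* I v_1 = v_2, I v_3 = v_4, I v_5 = v_6 *)
Definition hI v : 'rV[R]_6 :=
  \row_(k < 6) (if odd k then v 0 (inord k.-1) else - v 0 (inord k.+1)).

Definition dcomega u v w : R :=
  dual3 1 3 5 u v w + dual3 2 3 6 u v w + dual3 1 4 6 u v w - dual3 2 4 5 u v w.

(* An element of h_C^* is given by its coordinates in v^1, ..., v^6. *)
Definition covec (f : 'rV[R]_6 -> R) : 'rV[R]_6 := \row_k f (delta_mx 0 k).
Definition ev (b v : 'rV[R]_6) : R := \sum_k b 0 k * v 0 k.

End HeisenbergForms.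

(* h_C + i R + h_C^*: the triple ((v, s), b) stands for v + i s + b. *)
Definition gmnp (R : realType) := ('rV[R]_6 * R^o * 'rV[R]_6)%type.

Section QuadraticLie.
Variables (R : realType) (m n p : R).
Local Notation g := (gmnp R).

(* F = i F_i, with values in i R *)
Definition F_i (v w : 'rV[R]_6) : R :=
  2 * pi * (m * (dual2 3 4 v w - dual2 1 2 v w)
            + n * (dual2 2 3 v w - dual2 1 4 v w)
            + p * (dual2 1 3 v w + dual2 2 4 v w)).

Definition alpha : R := (2 * pi ^+ 2 * (m ^+ 2 + n ^+ 2 + p ^+ 2))^-1.

(* The polarization of (v+r+b|v+r+b) = b(v) - alpha r^2; r = i s and t = i s'
   give - alpha r t = alpha s s'. *)
Definition gform (x y : g) : R :=
  let: (v, s, b) := x in let: (w, s', e) := y in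
  (ev b w + ev e v) / 2 + alpha * (s * s').

(* For r = i s and t = i s',
   2 alpha (r i_w F - t i_v F) = - 2 alpha (s i_w F_i - s' i_v F_i). *)
Definition gbr (x y : g) : g :=
  let: (v, s, b) := x in let: (w, s', e) := y in
  (hbr v w, - F_i v w,
   - covec (fun z => ev e (hbr v z)) + covec (fun z => ev b (hbr w z))
   - covec (fun z => dcomega v w z)
   - (2 * alpha) *: (s *: covec (F_i w) - s' *: covec (F_i v))).

End QuadraticLie.

Section Isotropic.
Variable R : realType.
Local Notation g := (gmnp R).
Local Notation gC := (cplx g).

(* v + g(v), where g = sum_i v^i (x) v^i *)
Definition vplus (v : 'rV[R]_6) : g := (v, 0, v).
Definition Vplus : set g := range vplus.
Definition Vminus (m n p : R) : set g :=
  [set y | forall x, Vplus x -> gform m n p x y = 0].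

(* v + g(v) |-> I v + g(I v), extended to all of g through the projection to h_C;
   only its values on V_+ matter. *)
Definition Iplus (x : g) : g := vplus (hI x.1.1).

Definition Vplus10 : set gC :=
  [set u | cplx_set Vplus u /\ cplx_map Iplus u = 'i *: u].
Definition Vplus01 : set gC :=
  [set u | cplx_set Vplus u /\ cplx_map Iplus u = - 'i *: u].

(* The component of u in A, for the decomposition gC = A + B + V_-^C; it is
   unique for {A, B} = {V_+^{1,0}, V_+^{0,1}}. *)
Definition proj (m n p : R) (A B : set gC) (u : gC) : gC :=
  xget 0 [set a | A a /\ exists b c,
    [/\ B b, cplx_set (Vminus m n p) c & u = a + b + c]].

Definition basis3 (A : set gC) (e : 'I_3 -> gC) : Prop :=
  (forall j, A (e j)) /\
  forall u, A u -> exists! x : 'rV[R[i]]_3, u = \sum_j x 0 j *: e j.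

End Isotropic.

Section Generators.
Variables (R : realType) (m n p : R) (k : R[i]).
Local Notation gC := (cplx (gmnp R)).
Variables (V : susyVA R[i]) (Pi : gC -> V) (eps epsb : 'I_3 -> gC).

Local Notation brkC := (cplx_brk (gbr m n p)).
Local Notation e_ := (fun j => Pi (eps j)).
Local Notation e' := (fun j => Pi (epsb j)).

(* e_ j and e' j are the e_j and e^j of the parity-reversed algebra. *)
Definition J0 : V := ('i / k) *: \sum_j nop (e' j) (e_ j).

Definition w_ : gC :=
  let u := \sum_j brkC (epsb j) (eps j) in
  proj m n p (@Vplus10 R) (@Vplus01 R) u - proj m n p (@Vplus01 R) (@Vplus10 R) u.

Definition H' : V :=
  k^-1 *: \sum_j (nop (e_ j) (opSV (e' j)) + nop (e' j) (opSV (e_ j)))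
  + k ^- 2 *: \sum_j \sum_r
      (nop (e_ j) (nop (e' r) (Pi (brkC (epsb j) (eps r))))
       + nop (e' j) (nop (e_ r) (Pi (brkC (eps j) (epsb r))))
       - nop (e_ j) (nop (e_ r) (Pi (brkC (epsb j) (epsb r))))
       - nop (e' j) (nop (e' r) (Pi (brkC (eps j) (eps r)))))
  + k^-1 *: opTV (Pi w_).

End Generators.

(* Main.v *)
(* Let e_j, e^j be dual bases of l and lbar, and omega = sum_j :e^j e_j:, so that
   J = (i/k) omega. The Wick formula gives
   [omega_Lambda omega] = h + 3 k^2 lambda chi with h = k^2 H'; the coefficients
   of chi and lambda vanish because sum_j [e^j, e_j] = 0.

   The Jacobi identity for (J, J, J) reads
   - [J_Lambda H] = [H_(Lambda+Gamma) J] + [J_Gamma H]. It kills the coefficients of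
   [H_Lambda J] of lambda chi and of lambda^n for n > 1, and together with
   skew-symmetry it expresses the constant coefficient through those of chi and
   lambda. The Jacobi identity for (H, J, J) then gives [H_Lambda H]. So everything
   reduces to the coefficients of chi and lambda in [omega_Lambda h]. These are
   computed from the Wick formula, using that l and lbar are isotropic and closed
   under the bracket, that sum_j [e^j, e_j] = 0, and the Jacobi identity of g.

   For g_(m,n,p) one checks that V_+^(1,0) and V_+^(0,1) are subalgebras and that
   sum_j [e^j, e_j] = 0; in particular w = 0. The Jacobi identity of g and the
   invariance of its form need no check: they follow from the axioms of V. *)

Require Import Defs.
From mathcomp Require Import all_boot all_order all_algebra.
From mathcomp Require Import complex ring.
From mathcomp Require Import boolp classical_sets functions fsbigop reals trigo.

Set Implicit Arguments.
Unset Strict Implicit.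
Unset Printing Implicit Defensive.

Import GRing.Theory Num.Theory.

Local Open Scope classical_set_scope.
Local Open Scope ring_scope.

(** The general part does not assume [Pi] injective, so identities of g are used only through their
    images: [brk] is handled after applying [Pi], and [form] is read off the coefficient of the
    vacuum, which requires [vac V != 0]. If the vacuum is zero, so is V, and every relation is
    trivial. The obstacle in [omega_Lambda h] is that [e_i, e^j] has components in all of l, lbar
    and V_-. The coefficient of chi in [omega_Lambda -] acts on g as -k times the operator equal to
    1 on l, -1 on lbar and 0 on V_-, so each component enters with its own weight. The unwanted
    terms disappear only after summation over the dual bases: they are traces governed by sum_j
    [e^j, e_j] = 0, or they cancel in pairs by the total antisymmetry of ([x, y]|z). Exchanging l
    and lbar changes the sign of omega, which halves the work. The central charge is 3 dim l = 9:
    each dual pair contributes k^2 to the coefficient of lambda chi in [omega_Lambda omega]. *)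

Lemma fsum_nat_bound (W : nmodType) (F : nat -> W) N :
  (forall n, (N <= n)%N -> F n = 0) ->
  \sum_(n \in [set: nat]) F n = \sum_(n < N) F n.
Proof.
move=> F0; rewrite (fsbig_ord _ _ F); apply/esym/fsbig_widen => // n [_ /= nN].
by apply: F0; rewrite leqNgt; apply/negP.
Qed.

(** * Lambda-polynomials *)

Section LambdaPolynomialLemmas.
Variables (K : numFieldType).

Lemma lsum_bound (W : lmodType K) (F : lpoly W) N :
  (forall n q, (N <= n)%N -> F n q = 0) ->
  lsum F = \sum_(n < N) (F n false + F n true).
Proof. by move=> F0; apply: fsum_nat_bound => n Nn; rewrite !F0 ?addr0. Qed.

Lemma lamM0 (W : lmodType K) : lamM (0 : lpoly W) = 0.
Proof. by apply/funext => -[|n]; apply/funext. Qed.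

Lemma chiM0 (W : lmodType K) : chiM (0 : lpoly W) = 0.
Proof. by apply/funext => n; apply/funext => -[]; rewrite /chiM ?lamM0 ?oppr0. Qed.

Lemma iter_fix0 (T : nmodType) (f : T -> T) n : f 0 = 0 -> iter n f 0 = 0.
Proof. by move=> f0; elim: n => //= n ->. Qed.

Lemma lpoly_sumE (W : lmodType K) I r (P : pred I) (F : I -> lpoly W) n q :
  (\sum_(i <- r | P i) F i) n q = \sum_(i <- r | P i) F i n q.
Proof. by rewrite !fct_sumE. Qed.

Lemma int_nabla_linear (V : lmodType K) (S : V -> V) (P : lpoly V) :
  S 0 = 0 -> (forall n, P n.+1 true = 0) ->
  int_nabla S P = S (S (P 0 true)).
Proof.
move=> S0 P0; rewrite /int_nabla (@fsum_nat_bound _ _ 1); last first.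
  by case=> // n _; rewrite P0 iter_fix0 ?scaler0 //= !S0.
by rewrite big_ord1 /= expr0 divr1 scale1r.
Qed.

Definition addL (W : lmodType K) (P : lpoly (lpoly W)) : lpoly (lpoly W) :=
  lamM P + evenM (@lamM K W) P.
Definition addX (W : lmodType K) (P : lpoly (lpoly W)) : lpoly (lpoly W) :=
  chiM P + Defs.oddM (@chiM K W) P.

Lemma iter_addX (W : lmodType K) (q : bool) (w : W) a s b r :
  (iter q (@addX W) (pconst (pconst w))
     : lpoly (lpoly W)) a s b r =
  if [&& a == 0%N, b == 0%N, ~~ (s && r) & (s || r) == q] then w else 0.
Proof.
case: q => /=; rewrite /addX ?addrfctE /chiM /Defs.oddM /lamM /pconst.
  by case: a s b r => [|[|a]] [] [|[|b]] [] //=;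
    rewrite ?scalrfctE ?opprfctE /= ?(oppr0, addr0, add0r, scaler0, expr0, scale1r,
      oppr0) //.
by case: a s b r => [|a] [] [|b] [].
Qed.

(** The binomial theorem for (lambda + gamma)^n, applied to a [P] free of lambda and gamma. *)
Lemma iter_addL (W : lmodType K) n (P : lpoly (lpoly W)) a s b r :
  (forall a b, (a + b != 0)%N -> P a s b r = 0) ->
  (iter n (@addL W) P : lpoly (lpoly W)) a s b r =
  if (a + b == n)%N then P 0%N s 0%N r *+ 'C(n, a) else 0.
Proof.
move=> P0; elim: n a b => [|n IH] a b /=.
  case: eqP => [/eqP|/eqP/P0//]; rewrite addn_eq0 => /andP[/eqP-> /eqP->].
  by rewrite bin0.
have -> : addL (iter n (@addL W) P) a s b r =
    (if a is a'.+1 then (iter n (@addL W) P : lpoly (lpoly W)) a' s b r else 0)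
    + (if b is b'.+1 then (iter n (@addL W) P : lpoly (lpoly W)) a s b' r else 0).
  by case: a b => [|a] [|b].
case: a b => [|a] [|b]; rewrite ?IH ?addr0 ?add0r //.
- by rewrite !add0n !bin0 eqSS.
- by rewrite !addn0 eqSS; case: eqP => // <-; rewrite !binn.
rewrite addSnnS addSn eqSS; case: eqP => [<-|]; last by rewrite addr0.
by rewrite binS mulrnDr addrC.
Qed.

(** The monomial lambda^a gamma^b arises only from (lambda + gamma)^(a + b), and chi eta never
    arises because chi + eta occurs at most once. *)
Lemma br_addE (V : lmodType K) (br : V -> V -> lpoly V) (u c : V) a s b r :
  (exists N, forall n q, (N <= n)%N -> br u c n q = 0) ->
  br_add br u c a s b r =
  if s && r then 0 else br u c (a + b)%N (s || r) *+ 'C(a + b, a).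
Proof.
case=> N brN.
have H n (q : bool) a1 s1 b1 r1 : (iter n (@addL V)
      (iter q (@addX V) (pconst (pconst (br u c n q))))
      : lpoly (lpoly V)) a1 s1 b1 r1 =
    if [&& (a1 + b1 == n)%N, ~~ (s1 && r1) & (s1 || r1) == q]
    then br u c n q *+ 'C(n, a1) else 0.
  rewrite iter_addL.
    rewrite iter_addX eqxx /=; case: (a1 + b1 == n)%N => //=.
    by case: ifP => // _; rewrite mul0rn.
  move=> a' b' ab0; rewrite iter_addX; case: ifP => // /andP[/eqP a0 /andP[/eqP b0
    _]].
  by rewrite a0 b0 in ab0.
(* The bound must exceed [a + b] as well, so that the sum still contains the index singled out
   below. *)
rewrite /br_add (@lsum_bound _ _ (maxn N (a + b).+1)); last first.
  move=> n q; rewrite geq_max => /andP[brNn _].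
  apply/funext => a'; apply/funext => s'; apply/funext => b'; apply/funext => r'.
  by rewrite (H n q) brN // mul0rn if_same.
rewrite !fct_sumE.
have abN : (a + b < maxn N (a + b).+1)%N by rewrite leq_max ltnSn orbT.
pose G i q := if [&& (a + b == i)%N, ~~ (s && r) & (s || r) == q]
  then br u c i q *+ 'C(i, a) else 0.
rewrite (eq_bigr (fun i : 'I__ => G i false + G i true)) {}/G; last first.
  by move=> i _; exact: (congr2 +%R (H i false a s b r) (H i true a s b r)).
rewrite (bigD1 (Ordinal abN)) //= big1 ?addr0; last first.
  move=> i /negP iab; have -> : (a + b == i)%N = false.
    by apply/negP => /eqP abi; apply: iab; apply/eqP/val_inj.
  by rewrite addr0.
by rewrite eqxx /=; case: s r => -[] /=; rewrite ?addr0 ?add0r.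
Qed.

(** The brackets to which skew-symmetry is applied below have degree at most 1 in lambda, so only 1,
    -chi - S, -lambda - T and the product of the last two have to be expanded. *)
Lemma br_skewE (V : lmodType K) (S : V -> V) (br : V -> V -> lpoly V) (b a : V) :
  linear S -> (forall n q, (1 < n)%N -> br b a n q = 0) ->
  let P := br b a in let Q := br_skew S br b a in
  [/\ Q 0%N false = P 0%N false - S (P 0%N true) - S (S (P 1%N false))
                    + S (S (S (P 1%N true))),
      Q 0%N true = - P 0%N true + S (S (P 1%N true)),
      Q 1%N false = - P 1%N false + S (P 1%N true),
      Q 1%N true = P 1%N true &
      forall n q, (1 < n)%N -> Q n q = 0].
Proof.
move=> lS P0 P Q.
have SD x y : S (x + y) = S x + S y by have := lS 1 x y; rewrite !scale1r.
have S0 : S 0 = 0 by apply: (addrI (S 0)); rewrite -SD !addr0.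
have SZ c x : S (c *: x) = c *: S x by have := lS c x 0; rewrite S0 !addr0.
have SN x : S (- x) = - S x by rewrite -scaleN1r SZ scaleN1r.
have QE n q : Q n q =
   (pconst (P 0%N false) + (- chiM (pconst (P 0%N true)) - opS S (pconst (P 0%N
     true)))
   + ((- lamM (pconst (P 1%N false)) - opT S (pconst (P 1%N false)))
      + (- lamM (- chiM (pconst (P 1%N true)) - opS S (pconst (P 1%N true)))
         - opT S (- chiM (pconst (P 1%N true)) - opS S (pconst (P 1%N true)))))) n q.
  rewrite /Q /br_skew (@lsum_bound _ _ 2) ?big_ord_recl ?big_ord0 /= ?addr0 //.
  move=> {}n {}q n1; rewrite P0 //.
  have -> : pconst 0 = 0 :> lpoly V.
    by apply/funext => i; apply/funext => t; rewrite /pconst; case: ifP.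
  have opS0 : opS S 0 = 0.
    apply/funext => i; apply/funext => t; rewrite /opS /Defs.oddM lamM0 S0 scaler0
      add0r.
    by case: t; rewrite ?scaler0.
  by rewrite !iter_fix0 ?chiM0 ?lamM0 /opT ?opS0 ?subr0 ?oppr0.
have opTE w n q : opT S (pconst w) n q = if (n == 0%N) && ~~ q then S (S w) else 0.
  rewrite /opT /opS /Defs.oddM /lamM /pconst.
  by case: n q => [|[|n]] [] /=;
    rewrite ?(S0, scaler0, addr0, add0r, expr0, expr1, scale1r, scaleN1r, SN,
      opprK, oppr0).
have opSE w n q : opS S (pconst w) n q = if (n == 0%N) && ~~ q then S w else 0.
  rewrite /opS /Defs.oddM /lamM /pconst.
  by case: n q => [|[|n]] [] /=;
    rewrite ?(S0, scaler0, addr0, add0r, expr0, expr1, scale1r, scaleN1r, SN,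
      opprK, oppr0).
(* S^2 commutes with chi: the two terms 2 lambda S produced by S chi = 2 lambda - chi S cancel. *)
have opTX w n q : opT S (- chiM (pconst w) - opS S (pconst w)) n q =
    if n == 0%N then - (if q then S (S w) else S (S (S w))) else 0.
  rewrite /opT /opS /Defs.oddM /chiM /lamM /pconst.
  case: n q => [|[|[|n]]] [] /=; rewrite ?addrfctE ?opprfctE /=;
    rewrite ?(S0, scaler0, addr0, add0r, expr0, expr1, scale1r, scaleN1r, SN, SD,
      SZ, opprK, oppr0, opprD, subrr) //.
  by rewrite -scalerDr addNr scaler0.
have {}QE n q : Q n q = pconst (P 0%N false) n q
    + (- chiM (pconst (P 0%N true)) n q - opS S (pconst (P 0%N true)) n q)
    + ((- lamM (pconst (P 1%N false)) n q - opT S (pconst (P 1%N false)) n q)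
       + (- lamM (- chiM (pconst (P 1%N true)) - opS S (pconst (P 1%N true))) n q
          - opT S (- chiM (pconst (P 1%N true)) - opS S (pconst (P 1%N true))) n q)).
  exact: QE.
have subE (A B : lpoly V) n q : (- A - B) n q = - A n q - B n q by [].
split; rewrite ?QE.
- by rewrite opTE opTX opSE /= /chiM /lamM /pconst /= !(oppr0, add0r, opprK) !addrA.
- by rewrite opTE opTX opSE /= /chiM /lamM /pconst /= !(oppr0, add0r, opprK, addr0).
- rewrite opTE opTX opSE /= subE opSE.
  by rewrite /chiM /lamM /pconst /= !(oppr0, add0r, opprK, addr0).
- rewrite opTE opTX opSE /= subE opSE.
  by rewrite /chiM /lamM /pconst /= !(oppr0, add0r, opprK, addr0).
case=> [|[|n]] // q _; rewrite QE opTE opTX opSE /=.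
rewrite !subE !opSE /chiM /lamM /pconst.
by case: q; case: n => [|n] /=; rewrite !(oppr0, add0r, opprK, addr0).
Qed.

End LambdaPolynomialLemmas.

(** * SUSY vertex algebras *)

Section LinearMaps.
Variables (K : numFieldType) (U W : lmodType K) (f : U -> W).
Hypothesis lf : linear f.

Lemma linD x y : f (x + y) = f x + f y.
Proof. by have := lf 1 x y; rewrite !scale1r. Qed.

Lemma lin0 : f 0 = 0.
Proof. by apply: (addrI (f 0)); rewrite -linD !addr0. Qed.

Lemma linZ c x : f (c *: x) = c *: f x.
Proof. by have := lf c x 0; rewrite lin0 !addr0. Qed.

Lemma linN x : f (- x) = - f x.
Proof. by rewrite -scaleN1r linZ scaleN1r. Qed.

Lemma linB x y : f (x - y) = f x - f y.
Proof. by rewrite linD linN. Qed.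

Lemma lin_sum I r (P : pred I) F :
  f (\sum_(i <- r | P i) F i) = \sum_(i <- r | P i) f (F i).
Proof. exact: (big_morph f linD lin0). Qed.

End LinearMaps.

(** A positive power of lambda or chi on the left never yields a constant coefficient, not even
    through chi^2 = - lambda. *)
Lemma lsum_constant_coef (K : numFieldType) (W : lmodType K)
    (B : nat -> bool -> lpoly W) N :
  (forall n q, (N <= n)%N -> B n q = 0) ->
  lsum (fun n q => (-1) ^+ q *: iter n (@lamM K W) (iter q (@chiM K W) (B n q)))
    0%N false = B 0%N false 0%N false.
Proof.
move=> B0; rewrite (@lsum_bound _ _ _ N.+1); last first.
  move=> n q Nn; rewrite (B0 _ _ (ltnW Nn)).
  by rewrite !iter_fix0 ?scaler0 ?lamM0 ?chiM0.
rewrite lpoly_sumE big_ord_recl big1 => [|i _]; last first.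
  change ((-1) ^+ false *: (0 : W) + (-1) ^+ true *: (0 : W) = 0).
  by rewrite !scaler0 addr0.
change ((-1) ^+ false *: B 0%N false 0%N false + (-1) ^+ true *: (- (0 : W)) + 0
  = B 0%N false 0%N false).
by rewrite expr0 scale1r oppr0 scaler0 !addr0.
Qed.

Section SusyVertexAlgebra.
Variables (K : numFieldType) (V : susyVA K).
Implicit Types (a b c : V) (x y : V).
Local Notation S := (@opSV K V).

Lemma br_coef_linl c n q : linear (fun a => br a c n q).
Proof. by move=> z a b; rewrite (br_linl c z a b). Qed.

Lemma br_coef_linr a n q : linear (fun b => br a b n q).
Proof. by move=> z b c; rewrite (br_linr a z b c). Qed.

Let nl c := @nop_linl K V c.
Let nr c := @nop_linr K V c.
Let Sl := @opSV_lin K V.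

Definition nopDl c a b : nop (a + b) c = nop a c + nop b c := linD (nl c) a b.
Definition nopDr c a b : nop c (a + b) = nop c a + nop c b := linD (nr c) a b.
Definition nopBl c a b : nop (a - b) c = nop a c - nop b c := linB (nl c) a b.
Definition nopBr c a b : nop c (a - b) = nop c a - nop c b := linB (nr c) a b.
Definition nopNl c a : nop (- a) c = - nop a c := linN (nl c) a.
Definition nopNr c a : nop c (- a) = - nop c a := linN (nr c) a.
Definition nopZl c z a : nop (z *: a) c = z *: nop a c := linZ (nl c) z a.
Definition nopZr c z a : nop c (z *: a) = z *: nop c a := linZ (nr c) z a.
Definition nop0l c : nop 0 c = 0 := lin0 (nl c).
Definition nop0r c : nop c 0 = 0 := lin0 (nr c).
Lemma nop_suml I r (P : pred I) (F : I -> V) c :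
  nop (\sum_(i <- r | P i) F i) c = \sum_(i <- r | P i) nop (F i) c.
Proof. exact: (lin_sum (nl c)). Qed.
Lemma nop_sumr I r (P : pred I) (F : I -> V) c :
  nop c (\sum_(i <- r | P i) F i) = \sum_(i <- r | P i) nop c (F i).
Proof. exact: (lin_sum (nr c)). Qed.

Section Coefficients.
Variables (n : nat) (q : bool).
Let bl c := @br_coef_linl c n q.
Let brr c := @br_coef_linr c n q.
Definition brDl c a b : br (a + b) c n q = br a c n q + br b c n q := linD (bl c) a b.
Definition brDr c a b : br c (a + b) n q = br c a n q + br c b n q := linD (brr c)
  a b.
Definition brBl c a b : br (a - b) c n q = br a c n q - br b c n q := linB (bl c) a b.
Definition brBr c a b : br c (a - b) n q = br c a n q - br c b n q := linB (brr c)
  a b.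
Definition brNl c a : br (- a) c n q = - br a c n q := linN (bl c) a.
Definition brNr c a : br c (- a) n q = - br c a n q := linN (brr c) a.
Definition brZl c z a : br (z *: a) c n q = z *: br a c n q := linZ (bl c) z a.
Definition brZr c z a : br c (z *: a) n q = z *: br c a n q := linZ (brr c) z a.
Definition br0l c : br 0 c n q = 0 := lin0 (bl c).
Definition br0r c : br c 0 n q = 0 := lin0 (brr c).
Lemma br_suml I r (P : pred I) (F : I -> V) c :
  br (\sum_(i <- r | P i) F i) c n q = \sum_(i <- r | P i) br (F i) c n q.
Proof. exact: (lin_sum (bl c)). Qed.
Lemma br_sumr I r (P : pred I) (F : I -> V) c :
  br c (\sum_(i <- r | P i) F i) n q = \sum_(i <- r | P i) br c (F i) n q.
Proof. exact: (lin_sum (brr c)). Qed.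
End Coefficients.

Definition opSVD a b : S (a + b) = S a + S b := linD Sl a b.
Definition opSVB a b : S (a - b) = S a - S b := linB Sl a b.
Definition opSVN a : S (- a) = - S a := linN Sl a.
Definition opSVZ z a : S (z *: a) = z *: S a := linZ Sl z a.
Definition opSV0 : S 0 = 0 := lin0 Sl.
Lemma opSV_sum I r (P : pred I) (F : I -> V) :
  S (\sum_(i <- r | P i) F i) = \sum_(i <- r | P i) S (F i).
Proof. exact: (lin_sum Sl). Qed.

Lemma homogD pa a b : homog pa a -> homog pa b -> homog pa (a + b).
Proof. by move=> ha hb; rewrite -[a]scale1r; apply: homogZD. Qed.

Lemma homogZ pa z a : homog pa a -> homog pa (z *: a).
Proof. by move=> ha; rewrite -[_ *: _]addr0; apply/homogZD/homog0. Qed.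

Lemma homog_bigsum pa I r (P : pred I) (F : I -> V) :
  (forall i, P i -> homog pa (F i)) -> homog pa (\sum_(i <- r | P i) F i).
Proof. by move=> hF; elim/big_ind: _ => //; [exact: homog0|exact: homogD]. Qed.

Lemma wickE pa pb a b c n q : homog pa a -> homog pb b ->
  br a (nop b c) n q = nop (br a b n q) c
    + (-1) ^+ (~~ pa && pb) *: ((-1) ^+ (q && pb) *: nop b (br a c n q))
    + \sum_(m < n) m.+1%:R^-1 *: br (br a b (n - m.+1)%N q) c m true.
Proof. by move=> ha hb; rewrite (br_wick c ha hb). Qed.

Lemma wick01 pb a b c : homog false a -> homog pb b ->
  br a (nop b c) 0 true = nop (br a b 0 true) c + nop b (br a c 0 true).
Proof.
move=> ha hb; rewrite (wickE _ _ _ ha hb) big_ord0 addr0 /=.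
by case: pb {hb}; rewrite ?expr0 ?expr1 ?scaleN1r ?scale1r ?opprK.
Qed.

Lemma wick10 pb a b c : homog false a -> homog pb b ->
  br a (nop b c) 1 false = nop (br a b 1 false) c
    + (-1) ^+ pb *: nop b (br a c 1 false) + br (br a b 0 false) c 0 true.
Proof.
move=> ha hb; rewrite (wickE _ _ _ ha hb) big_ord1 subnn invr1 scale1r /=.
by rewrite expr0 scale1r.
Qed.

Lemma opSV_vac : S (vac V) = 0.
Proof.
have := nop_S (vac V) (vac_even V); rewrite nop_vacl expr0 scale1r nop_vacl.
by rewrite nop_vacr => /eqP; rewrite -subr_eq subrr eq_sym => /eqP.
Qed.

(** The Wick formula for :vac vac: reads x = x + x + integral, and the integral at lambda^n involves
    only lower coefficients, zero by induction. *)
Lemma br_vacr pa a n q : homog pa a -> br a (vac V) n q = 0.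
Proof.
move=> ha; elim/ltn_ind: n => n IH.
have := @wickE _ _ a (vac V) (vac V) n q ha (vac_even V).
rewrite !nop_vacl nop_vacr !andbF !expr0 !scale1r big1 ?addr0; last first.
  move=> m _; rewrite IH ?br0l ?scaler0 //.
  by rewrite -subn_gt0 subKn.
by move/eqP; rewrite -subr_eq subrr eq_sym => /eqP.
Qed.

Lemma br_skewsymE pa pb a b : homog pa a -> homog pb b ->
  (forall n q, (1 < n)%N -> br b a n q = 0) ->
  let s : K := (-1) ^+ (pa && pb) in
  [/\ br a b 0%N false = s *: (br b a 0%N false - S (br b a 0%N true)
        - S (S (br b a 1%N false)) + S (S (S (br b a 1%N true)))),
      br a b 0%N true = s *: (- br b a 0%N true + S (S (br b a 1%N true))),
      br a b 1%N false = s *: (- br b a 1%N false + S (br b a 1%N true)),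
      br a b 1%N true = s *: br b a 1%N true &
      forall n q, (1 < n)%N -> br a b n q = 0].
Proof.
move=> ha hb b0; move=> s; case: (br_skewE (@opSV_lin K V) b0) => e1 e2 e3 e4 e5.
have E n q : br a b n q = s *: br_skew S br b a n q by rewrite (br_skewsym ha hb).
by split=> [||||n q n1]; rewrite E ?e1 ?e2 ?e3 ?e4 // e5 // scaler0.
Qed.

Lemma br_vacl pa a n q : homog pa a -> br (vac V) a n q = 0.
Proof.
move=> ha; have h m r : (1 < m)%N -> br a (vac V) m r = 0.
  by move=> _; rewrite (br_vacr _ _ ha).
have [] := br_skewsymE (vac_even V) ha h.
rewrite !(br_vacr _ _ ha) !opSV0 !oppr0 !addr0 !scaler0.
by case: n q => [|[|n]] [] // *; auto.
Qed.

(** In the coefficient of lambda, S chi = 2 lambda - chi S contributes 2 and chi^2 = - lambda takes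
    1 away. *)
Lemma br_opSV_even a b : homog false a ->
  [/\ br a (S b) 0%N false = - S (br a b 0%N false),
      br a (S b) 0%N true = S (br a b 0%N true) - br a b 0%N false,
      br a (S b) 1%N false = - S (br a b 1%N false) - br a b 0%N true,
      br a (S b) 1%N true = S (br a b 1%N true) - br a b 1%N false &
      forall n q, (forall m r, (n <= m.+1)%N -> br a b m r = 0) ->
        br a (S b) n q = 0].
Proof.
move=> ha; have E n q : br a (S b) n q =
    - (opS S (br a b) n q + chiM (br a b) n q).
  by rewrite (br_Sr b ha) expr0 scale1r.
rewrite !E /opS /Defs.oddM /chiM /lamM /= !expr0 !expr1 !scale1r !scaleN1r.
rewrite !oppr0 !addr0 scaler0 addr0; split; rewrite ?opprD ?opprK //.
  rewrite -addrA; congr (_ + _); rewrite (_ : 2 = 1 + 1) // scalerDl !scale1r.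
  by rewrite opprD addrNK.
move=> n q h; rewrite E /opS /Defs.oddM /chiM /lamM; case: n q h => [|n] [] h /=;
by rewrite ?h // ?opSV0 !(scaler0, addr0, oppr0) ?h // ?opSV0 ?(scaler0, addr0,
  oppr0).
Qed.

Lemma br_opSV_odd a b : homog true a ->
  [/\ br a (S b) 0%N false = S (br a b 0%N false),
      br a (S b) 0%N true = br a b 0%N false - S (br a b 0%N true) &
      br a (S b) 1%N false = S (br a b 1%N false) + br a b 0%N true].
Proof.
move=> ha; have E n q : br a (S b) n q =
    opS S (br a b) n q + chiM (br a b) n q.
  by rewrite (br_Sr b ha) expr1 scaleN1r opprK.
rewrite !E /opS /Defs.oddM /chiM /lamM /= !expr0 !expr1 !scale1r !scaleN1r.
rewrite !(oppr0, addr0, scaler0); split => //; first by rewrite addrC.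
by rewrite -addrA; congr (_ + _); rewrite (_ : 2 = 1 + 1) // scalerDl !scale1r addrK.
Qed.

Lemma br_add_brE u c n q m r : br_add br u c n q m r =
  if q && r then 0 else br u c (n + m)%N (q || r) *+ 'C(n + m, n).
Proof. by rewrite br_addE //; exact: br_fin. Qed.

Lemma br_add0 c : br_add br 0 c = 0 :> lpoly (lpoly V).
Proof.
apply/funext => n; apply/funext => q; apply/funext => m; apply/funext => r.
by rewrite br_add_brE br0l mul0rn if_same.
Qed.

Lemma br_br_lE a b c n q m r :
  (forall i s, (1 < i)%N -> br a b i s = 0) ->
  let A i s : lpoly (lpoly V) := br_add br (br a b i s) c in
  br_br_l br a b c n q m r =
    A 0%N false n q m r - chiM (A 0%N true) n q m r
    + (lamM (A 1%N false) n q m r - lamM (chiM (A 1%N true)) n q m r).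
Proof.
move=> b0 A; rewrite /br_br_l (@lsum_bound _ _ _ 2); last first.
  move=> i s i1; rewrite b0 //.
  by rewrite br_add0 !iter_fix0 ?scaler0 ?lamM0 ?chiM0.
rewrite !big_ord_recl big_ord0 addr0 /= expr0 expr1 !scale1r !scaleN1r.
by case: n.
Qed.

Lemma jacobiE pa pb a b c n q m r : homog pa a -> homog pb b ->
  (-1) ^+ (r && (~~ pa (+) q)) *: br a (br b c m r) n q =
  (-1) ^+ (~~ pa) *: br_br_l br a b c n q m r
  + (-1) ^+ (~~ pa && ~~ pb) *: ((-1) ^+ (q && ~~ pb) *: br b (br a c n q) m r).
Proof.
move=> ha hb; have := br_jacobi c ha hb.
by move/(congr1 (fun P : lpoly (lpoly V) => P n q m r)).
Qed.

Lemma br_br_l_mode a b c m r :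
  br_br_l br a b c 0%N false m r = br (br a b 0%N false) c m r.
Proof.
rewrite /br_br_l; have [N b0] := br_fin a b.
rewrite (@lsum_constant_coef _ _ (fun n q => br_add br (br a b n q) c) N); last first.
  by move=> n q Nn; rewrite (b0 _ _ Nn) br_add0.
by rewrite br_add_brE add0n bin0 mulr1n.
Qed.

(** The Lambda-constant part of the Jacobi identity: up to signs, this mode of a acts as a
    derivation of every coefficient of a bracket. *)
Lemma jacobi_mode pa pb a b c m r : homog pa a -> homog pb b ->
  (-1) ^+ (r && ~~ pa) *: br a (br b c m r) 0%N false =
  (-1) ^+ (~~ pa) *: br (br a b 0%N false) c m r
  + (-1) ^+ (~~ pa && ~~ pb) *: br b (br a c 0%N false) m r.
Proof.
move=> ha hb; have := jacobiE c 0 false m r ha hb.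
by rewrite br_br_l_mode addbF expr0 scale1r.
Qed.

End SusyVertexAlgebra.

(** * A criterion for the N = 2 relations *)

Section N2Criterion.
Variables (K : numFieldType) (V : susyVA K) (c : K) (J H : V).
Local Notation S := (@opSV K V).
Hypotheses (hJ : homog false J) (hH : homog true H).
Hypothesis JJ :
  br J J = - (pconst H + (c / 3) *: lamM (chiM (pconst (vac V)))).
Hypotheses (JH01 : br J H 0%N true = - S J) (JH10 : br J H 1%N false = - (2 *: J)).

Let JJE n q : br J J n q = match n, q with
  | 0%N, false => - H | 1%N, true => - ((c / 3) *: vac V) | _, _ => 0 end.
Proof.
rewrite JJ opprfctE opprfctE addrfctE addrfctE scalrfctE scalrfctE.
by case: n q => [|[|[|n]]] [] /=; rewrite /pconst /lamM /chiM /lamM /= ?oppr0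
  !(scaler0, addr0, add0r, oppr0).
Qed.

Let JJ_big n q : (1 < n)%N -> br J J n q = 0.
Proof. by rewrite JJE; case: n => [|[|n]]. Qed.

Let jacJJJ n q m r :
  (-1) ^+ (r && ~~ q) *: br J (br J J m r) n q =
  (if q && r then 0 else br H J (n + m)%N (q || r) *+ 'C(n + m, n))
  - (-1) ^+ q *: br J (br J J n q) m r.
Proof.
have := jacobiE J n q m r hJ hJ.
have -> : ~~ false (+) q = ~~ q by case: q.
move=> ->; rewrite !expr1 !scaleN1r andbT; congr (_ - _).
rewrite br_br_lE // !JJE.
have A1 : br_add br (- ((c / 3) *: vac V)) J = 0 :> lpoly (lpoly V).
  apply/funext => n1; apply/funext => q1; apply/funext => m1; apply/funext => r1.
  by rewrite br_add_brE brNl brZl (br_vacl _ _ hJ) scaler0 oppr0 mul0rn if_same.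
rewrite br_add0 A1 chiM0 lamM0 br_add_brE brNl mulNrn.
change (- ((if q && r then 0 else - (br H J (n + m)%N (q || r) *+ 'C(n + m, n)))
  - 0 + (0 - 0)) = if q && r then 0 else br H J (n + m)%N (q || r) *+ 'C(n + m, n)).
by rewrite !(subr0, addr0); case: ifP; rewrite ?oppr0 ?opprK.
Qed.

(* The value of [H_Lambda J] at 0 comes out of the equation x = 2 (3 y - x). *)
Lemma N2_relations_of_JJ : N2_relations c J H.
Proof.
have JV n q : br J (vac V) n q = 0 by exact: br_vacr hJ.
have X01 : br H J 0%N true = S J.
  have := jacJJJ 0 true 0 false; rewrite !JJE brNr JH01 br0r scaler0 subr0.
  by rewrite /= expr0 scale1r opprK mulr1n.
have X10 : br H J 1%N false = 2 *: J.
  have := jacJJJ 1 false 0 false; rewrite !JJE brNr JH10 br0r scaler0 subr0.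
  by rewrite /= expr0 scale1r opprK mulr1n.
have X11 : br H J 1%N true = 0.
  have := jacJJJ 1 false 0 true; rewrite !JJE !br0r !scaler0 subr0 /=.
  by rewrite mulr1n.
have Xbig n q : (1 < n)%N -> br H J n q = 0.
  (* [J_Gamma J] has no term in gamma alone, so this coefficient of the identity has left side 0;
     the binomial coefficient n + 2 that remains is invertible. *)
  case: n => [|[|n]] // _; have := jacJJJ n.+1 q 1 false.
  rewrite !JJE br0r scaler0 andbF orbF addn1 binSn.
  have -> : br J (match n.+1, q return V with
     | 0%N, false => - H | 1%N, true => - ((c / 3) *: vac V) | _, _ => 0 end) 1
       false = 0.
    by case: n q => [|n] [] /=; rewrite ?br0r // brNr brZr JV scaler0 oppr0.
  rewrite scaler0 subr0 => /esym/eqP; rewrite -scaler_nat scaler_eq0 pnatr_eq0.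
  by move=> /eqP.
have X00 : br H J 0%N false = 2 *: S (S J).
  have := jacJJJ 0 false 0 false; rewrite !JJE /= expr0 !scale1r mulr1n brNr.
  have [-> _ _ _ _] := br_skewsymE hJ hH Xbig.
  rewrite X01 X10 X11 !opSVZ !opSV0 addr0 /= expr0 scale1r opprK.
  move: (br H J 0%N false) (S (S J)) => x y E.
  have {}E : 3 *: x = 3 *: (2 *: y).
    move: E; rewrite -addrA -opprD; set w := y + _ => /eqP.
    rewrite opprB eq_sym addrA subr_eq addrAC eq_sym subr_eq => /eqP ww.
    have -> : 3 *: x = x + x + x by rewrite !scaler_nat !mulrS mulr0n addr0 addrA.
    have -> : 3 *: (2 *: y) = w + w by rewrite /w !scaler_nat !mulrS mulr0n !addr0
      !addrA.
    by rewrite ww.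
  by apply: (scalerI (_ : 3%:R != 0)) E; rewrite pnatr_eq0.
have HJ : br H J = pconst (2 *: opTV J) + 2 *: lamM (pconst J)
               + chiM (pconst (opSV J)).
  apply/funext => n; apply/funext => q.
  change (br H J n q = pconst (2 *: opTV J) n q + 2 *: lamM (pconst J) n q
               + chiM (pconst (opSV J)) n q).
  by case: n q => [|[|n]] [] /=; rewrite /pconst /lamM /chiM /lamM /= ?X01 ?X10
    ?X11 ?X00
    ?Xbig // ?(oppr0, scaler0, addr0, add0r).
split => //.
have JTJ : br J (S (S J)) 0%N false = - S (S H).
  have [E _ _ _ _] := br_opSV_even (S J) hJ; rewrite E.
  have [-> _ _ _ _] := br_opSV_even J hJ.
  by rewrite JJE !opSVN opprK.
have JSJ : br J (S J) 0%N false = S H.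
  by have [-> _ _ _ _] := br_opSV_even J hJ; rewrite JJE opSVN opprK.
(* -H is the constant coefficient of [J_Gamma J], so the Jacobi identity for (H, J, J) at Gamma = 0
   expresses [H_Lambda H] through brackets that are already known. *)
have E n q : br H H n q =
   - (2 *: br (S (S J)) J n q - chiM (br (S J) J) n q + 2 *: lamM (br J J) n q
     + (-1) ^+ q *: br J (br H J n q) 0%N false).
  have := jacobiE J n q 0 false hH hJ.
  rewrite JJE br_br_lE // /= !expr0 !scale1r brNr => /(congr1 -%R).
  rewrite opprK => ->; congr (- (_ + _)); last by rewrite andbT.
  rewrite X00 X01 X10 X11.
  have ev u : (fun n q => br_add br u J n q 0%N false) = br u J.
    apply/funext => i; apply/funext => s.
    by rewrite br_add_brE andbF orbF addn0 binn mulr1n.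
  have chi_ev (P : lpoly (lpoly V)) i s :
    chiM P i s 0%N false = chiM (fun n q => P n q 0%N false) i s by case: i s =>
      [|i] [].
  have lam_ev (P : lpoly (lpoly V)) i s :
    lamM P i s 0%N false = lamM (fun n q => P n q 0%N false) i s by case: i.
  have -> : lamM (chiM (br_add br 0 J)) n q 0%N false = 0.
    rewrite lam_ev; case: n => //= n; rewrite chi_ev ev /chiM /lamM.
    by case: q n => -[|n]; rewrite ?br0l ?oppr0.
  rewrite chi_ev lam_ev !ev subr0 br_add_brE andbF orbF addn0 binn mulr1n brZl;
    congr (_ + _).
  by case: n => [|n]; rewrite /lamM ?scaler0 // brZl.
apply/funext => n; apply/funext => q; rewrite E {E} !br_Sl HJ.
change (- (2 *: chiM (chiM (br J J)) n q - chiM (chiM (br J J)) n q + 2 *: lamM (br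
  J J) n q +
   (-1) ^+ q *: br J (pconst (2 *: opTV J) n q + 2 *: lamM (pconst J) n q + chiM
     (pconst (S J)) n q) 0%N false) =
  pconst (2 *: opTV H) n q + chiM (pconst (S H)) n q + 3 *: lamM (pconst H) n q +
  (c / 3) *: chiM (lamM (lamM (pconst (vac V)))) n q).
case: n q => [|[|[|n]]] [] /=; rewrite /chiM /lamM /pconst /= ?JJE;
  rewrite ?(oppr0, opprK, scaler0, addr0, add0r, br0r, expr1, expr0, scaleN1r,
    scale1r, scalerN, brZr, JSJ, JTJ, JJE) //.
- rewrite [2 *: H - H - _]addrAC subrr sub0r -opprD opprK.
  by rewrite -{1}[H]scale1r -scalerDl -(natrD _ 1 2).
- by rewrite addrAC subrr add0r opprK.
by rewrite andbF scaler0 oppr0.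
Qed.

End N2Criterion.

(** * Polarizations of a superaffine vertex algebra *)

Section Superaffine.
Variables (K : numFieldType) (V : susyVA K) (g : lmodType K).
Variables (brk : g -> g -> g) (form : g -> g -> K) (k : K) (Pi : g -> V).
Hypotheses (hPi : superaffine_map brk form k Pi).
Local Notation S := (@opSV K V).
Implicit Types x y z : g.

Lemma Pi_odd x : homog true (Pi x).
Proof. by case: hPi. Qed.

Lemma Pi_lin : linear Pi.
Proof. by case: hPi. Qed.

Definition PiD x y : Pi (x + y) = Pi x + Pi y := linD Pi_lin x y.
Definition PiN x : Pi (- x) = - Pi x := linN Pi_lin x.
Definition PiB x y : Pi (x - y) = Pi x - Pi y := linB Pi_lin x y.
Definition PiZ a x : Pi (a *: x) = a *: Pi x := linZ Pi_lin a x.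
Definition Pi0 : Pi 0 = 0 := lin0 Pi_lin.
Lemma Pi_sum I r (P : pred I) (F : I -> g) :
  Pi (\sum_(i <- r | P i) F i) = \sum_(i <- r | P i) Pi (F i).
Proof. exact: (lin_sum Pi_lin). Qed.

Lemma br_PiE x y n q : br (Pi x) (Pi y) n q = match n, q with
  | 0%N, false => Pi (brk x y) | 0%N, true => (k * form x y) *: vac V | _, _ => 0 end.
Proof.
case: hPi => _ _ ->.
change (pconst (Pi (brk x y)) n q + chiM (pconst ((k * form x y) *: vac V)) n q =
  match n, q with
  | 0%N, false => Pi (brk x y) | 0%N, true => (k * form x y) *: vac V | _, _ => 0
    end).
by case: n q => [|[|n]] [] //=; rewrite /pconst /chiM /lamM /= ?oppr0 ?addr0 ?add0r.
Qed.

(* No property of [brk] or [form] is assumed: what is needed of them is read off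
   the axioms of V, up to the kernel of Pi for [brk], and as soon as V is nonzero
   for [form]. *)
Lemma Pi_br_lin_l y : linear (fun x => Pi (brk x y)).
Proof. by move=> a x x'; rewrite -!(br_PiE _ y 0 false) Pi_lin brDl brZl. Qed.

Lemma Pi_br_lin_r x : linear (fun y => Pi (brk x y)).
Proof. by move=> a y y'; rewrite -!(br_PiE x _ 0 false) Pi_lin brDr brZr. Qed.

Lemma Pi_brl x x' y : Pi x = Pi x' -> Pi (brk x y) = Pi (brk x' y).
Proof. by move=> E; rewrite -!(br_PiE _ y 0 false) E. Qed.

Lemma Pi_brr x y y' : Pi y = Pi y' -> Pi (brk x y) = Pi (brk x y').
Proof. by move=> E; rewrite -!(br_PiE x _ 0 false) E. Qed.

Lemma Pi_brC x y : Pi (brk x y) = - Pi (brk y x).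
Proof.
have big0 n q : (1 < n)%N -> br (Pi y) (Pi x) n q = 0.
  by rewrite br_PiE; case: n q => [|[|n]] [].
have [+ _ _ _ _] := br_skewsymE (Pi_odd x) (Pi_odd y) big0.
by rewrite !br_PiE !opSVZ opSV_vac !opSV0 scaler0 !subr0 addr0 expr1 scaleN1r.
Qed.

Lemma Pi_jacobi x y z : Pi (brk x (brk y z)) = Pi (brk (brk x y) z) + Pi (brk y
  (brk x z)).
Proof.
have := jacobi_mode (Pi z) 0 false (Pi_odd x) (Pi_odd y).
by rewrite !br_PiE /= ?br_PiE !expr0 !scale1r.
Qed.

Lemma opSV_scale_vac a : S (a *: vac V) = 0.
Proof. by rewrite opSVZ opSV_vac scaler0. Qed.

Definition Pi_brBl x y z : Pi (brk (x - y) z) = Pi (brk x z) - Pi (brk y z) :=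
  linB (Pi_br_lin_l z) x y.
Definition Pi_brNl x z : Pi (brk (- x) z) = - Pi (brk x z) :=
  linN (Pi_br_lin_l z) x.
Definition Pi_brDr x y z : Pi (brk z (x + y)) = Pi (brk z x) + Pi (brk z y) :=
  linD (Pi_br_lin_r z) x y.
Definition Pi_brBr x y z : Pi (brk z (x - y)) = Pi (brk z x) - Pi (brk z y) :=
  linB (Pi_br_lin_r z) x y.
Definition Pi_brZl a x z : Pi (brk (a *: x) z) = a *: Pi (brk x z) :=
  linZ (Pi_br_lin_l z) a x.
Definition Pi_brZr a x z : Pi (brk z (a *: x)) = a *: Pi (brk z x) :=
  linZ (Pi_br_lin_r z) a x.
Definition Pi_br0r z : Pi (brk z 0) = 0 := lin0 (Pi_br_lin_r z).
Lemma Pi_br_suml I r (P : pred I) (F : I -> g) z :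
  Pi (brk (\sum_(i <- r | P i) F i) z) = \sum_(i <- r | P i) Pi (brk (F i) z).
Proof. exact: (lin_sum (Pi_br_lin_l z)). Qed.
Lemma Pi_br_sumr I r (P : pred I) (F : I -> g) z :
  Pi (brk z (\sum_(i <- r | P i) F i)) = \sum_(i <- r | P i) Pi (brk z (F i)).
Proof. exact: (lin_sum (Pi_br_lin_r z)). Qed.


Definition quad x y : V := nop (Pi x) (Pi y).

Lemma quad_linl y : linear (quad^~ y).
Proof. by move=> a x x'; rewrite /quad Pi_lin nopDl nopZl. Qed.
Lemma quad_linr x : linear (quad x).
Proof. by move=> a x' y; rewrite /quad Pi_lin nopDr nopZr. Qed.

Definition quadBl x y z : quad (x - y) z = quad x z - quad y z := linB (quad_linl
  z) x y.
Definition quadBr x y z : quad z (x - y) = quad z x - quad z y := linB (quad_linr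
  z) x y.
Definition quadNl x z : quad (- x) z = - quad x z := linN (quad_linl z) x.
Definition quadZl a x z : quad (a *: x) z = a *: quad x z := linZ (quad_linl z) a x.
Definition quadZr a x z : quad z (a *: x) = a *: quad z x := linZ (quad_linr z) a x.
Lemma quad_suml I r (P : pred I) (F : I -> g) y :
  quad (\sum_(i <- r | P i) F i) y = \sum_(i <- r | P i) quad (F i) y.
Proof. exact: (lin_sum (quad_linl y)). Qed.
Lemma quad_sumr I r (P : pred I) (F : I -> g) y :
  quad y (\sum_(i <- r | P i) F i) = \sum_(i <- r | P i) quad y (F i).
Proof. exact: (lin_sum (quad_linr y)). Qed.

Lemma homog_quad x y : homog false (quad x y).
Proof. exact: (nop_even (Pi_odd x) (Pi_odd y)). Qed.

(** The correction in quasicommutativity is T of a multiple of the vacuum. *)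
Lemma quadC x y : quad x y = - quad y x.
Proof.
have := nop_quasicomm (Pi_odd x) (Pi_odd y).
rewrite int_nabla_linear ?opSV0 // => [|n]; last by rewrite br_PiE.
rewrite br_PiE opSV_scale_vac opSV0 expr1 scaleN1r opprK => /eqP.
by rewrite addr_eq0 => /eqP.
Qed.

(* The quasiassociativity corrections cancel after symmetrization in x and y. *)
Lemma nop3C x y z : nop (Pi x) (quad y z) = - nop (Pi y) (quad x z).
Proof.
have := nop_quasiassoc (Pi z) (Pi_odd x) (Pi_odd y).
have := nop_quasiassoc (Pi z) (Pi_odd y) (Pi_odd x).
rewrite /= !expr1 !scaleN1r -!/(quad _ _) [quad y x]quadC nopNl => E1 E2.
have {E1 E2} := congr2 +%R E1 E2.
rewrite addrACA addNr add0r addrA subrK subrr -opprD => /eqP.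
by rewrite oppr_eq0 addrC addr_eq0 => /eqP.
Qed.

(** The integral in the Wick formula contributes only the term k ([x, y]|z) lambda times the
    vacuum. *)
Lemma br_Pi_quad x y z n q : br (Pi x) (quad y z) n q = match n, q with
  | 0%N, false => quad (brk x y) z + quad y (brk x z)
  | 0%N, true => k *: Pi (form x y *: z - form x z *: y)
  | 1%N, false => (k * form (brk x y) z) *: vac V
  | _, _ => 0 end.
Proof.
rewrite (wickE _ _ _ (Pi_odd x) (Pi_odd y)) /= expr0 scale1r andbT !br_PiE.
case: n q => [|n] q.
  rewrite big_ord0 addr0; case: q => /=; last by rewrite expr0 scale1r.
  by rewrite nopZl nopZr nop_vacl nop_vacr expr1 scaleN1r PiB !PiZ scalerBr !scalerA.
rewrite nop0l nop0r scaler0 !add0r big_ord_recl big1 => [|i _]; last first.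
  rewrite br_PiE lift0; case: (_ - _)%N q => [|m] [];
  by rewrite ?br_PiE ?brZl ?(br_vacl _ _ (Pi_odd z)) ?br0l ?scaler0.
rewrite addr0 invr1 scale1r subSS subn0 br_PiE.
case: n q => [|n] [] /=; rewrite ?br0l ?br_PiE //.
by rewrite brZl (br_vacl _ _ (Pi_odd z)) scaler0.
Qed.

Lemma br_quad_Pi x y z n q : br (quad y z) (Pi x) n q = match n, q with
  | 0%N, false => quad (brk x y) z + quad y (brk x z) - S (k *: Pi (form x y *: z -
    form x z *: y))
  | 0%N, true => - (k *: Pi (form x y *: z - form x z *: y))
  | 1%N, false => - ((k * form (brk x y) z) *: vac V)
  | _, _ => 0 end.
Proof.
have big0 m r : (1 < m)%N -> br (Pi x) (quad y z) m r = 0.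
  by rewrite br_Pi_quad; case: m r => [|[|m]] [].
have := br_skewsymE (homog_quad y z) (Pi_odd x) big0.
rewrite !br_Pi_quad /= opSV_scale_vac expr0 !scale1r !opSV0 !addr0 subr0.
by case=> E1 E2 E3 E4 E; case: n q => [|[|n]] [] //; rewrite E.
Qed.

Hypotheses (hk : k != 0) (hvac : vac V != 0).

Lemma vac_scale_inj a b : (k * a) *: vac V = (k * b) *: vac V -> a = b.
Proof.
move/eqP; rewrite -subr_eq0 -scalerBl scaler_eq0 (negPf hvac) orbF subr_eq0.
by move=> /eqP/(mulfI hk).
Qed.

Lemma form_linl y : linear (form^~ y : g -> K^o).
Proof.
move=> a x x'; apply: vac_scale_inj.
rewrite -(br_PiE _ y 0 true) Pi_lin brDl brZl !br_PiE scalerA -scalerDl.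
by rewrite mulrDr; congr ((_ + _) *: _); rewrite /GRing.scale /= !mulrA [a * k]mulrC.
Qed.

Lemma formC x y : form x y = form y x.
Proof.
apply: vac_scale_inj; rewrite -!(br_PiE _ _ 0 true).
have big0 n q : (1 < n)%N -> br (Pi y) (Pi x) n q = 0.
  by rewrite br_PiE; case: n q => [|[|n]] [].
have [_ -> _ _ _] := br_skewsymE (Pi_odd x) (Pi_odd y) big0.
by rewrite !br_PiE !opSV0 addr0 expr1 scalerN scaleN1r opprK.
Qed.

Lemma form_linr x : linear (form x : g -> K^o).
Proof. by move=> a y y'; rewrite -![form x _]formC; exact: form_linl. Qed.

Definition formDl x y y' : form (x + y) y' = form x y' + form y y' := linD
  (form_linl y') x y.
Definition formNl x y' : form (- x) y' = - form x y' := linN (form_linl y') x.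
Definition formBl x y y' : form (x - y) y' = form x y' - form y y' := linB
  (form_linl y') x y.
Definition formZl a x y' : form (a *: x) y' = a * form x y' := linZ (form_linl y')
  a x.
Lemma form_suml I r (P : pred I) (F : I -> g) y :
  form (\sum_(i <- r | P i) F i) y = \sum_(i <- r | P i) (form (F i) y).
Proof. exact: (lin_sum (form_linl y)). Qed.
Lemma form_sumr I r (P : pred I) (F : I -> g) y :
  form y (\sum_(i <- r | P i) F i) = \sum_(i <- r | P i) (form y (F i)).
Proof. exact: (lin_sum (form_linr y)). Qed.
Definition form0l y : form 0 y = 0 := lin0 (form_linl y).
Definition formZr a x y : form x (a *: y) = a * form x y := linZ (form_linr x) a y.

Lemma form_Pi x x' y : Pi x = Pi x' -> form x y = form x' y.
Proof. by move=> E; apply: vac_scale_inj; rewrite -!(br_PiE _ y 0 true) E. Qed.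

Lemma form_PiN x x' y : Pi x = - Pi x' -> form x y = - form x' y.
Proof. by rewrite -PiN -formNl => /form_Pi. Qed.

Lemma form_brC x y z : form (brk x y) z = - form (brk y x) z.
Proof. exact/form_PiN/Pi_brC. Qed.

(** The zero mode of x is a derivation of [y_Lambda z], whose coefficient of chi is a multiple of
    the vacuum and is therefore annihilated. *)
Lemma form_inv x y z : form (brk x y) z = - form y (brk x z).
Proof.
have := jacobi_mode (Pi z) 0 true (Pi_odd x) (Pi_odd y).
rewrite !br_PiE /= brZr (br_vacr _ _ (Pi_odd x)) ?br_PiE !expr0 !scale1r scaler0.
rewrite -scalerDl -mulrDr => /esym E.
by apply/eqP; rewrite -addr_eq0; apply/eqP/vac_scale_inj; rewrite E mulr0 scale0r.
Qed.


Lemma quad_Pil x x' y : Pi x = Pi x' -> quad x y = quad x' y.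
Proof. by rewrite /quad => ->. Qed.

Lemma quad_Pir x y y' : Pi y = Pi y' -> quad x y = quad x y'.
Proof. by rewrite /quad => ->. Qed.

Lemma sum_quad_sym0 (I : finType) (F : I -> I -> g) :
  \sum_i \sum_j quad (F i j) (F j i) = 0.
Proof.
set s := \sum_i _; have : s = - s.
  rewrite {1}/s exchange_big -sumrN; apply: eq_bigr => i _.
  by rewrite -sumrN; apply: eq_bigr => j _; rewrite quadC.
move/eqP; rewrite -addr_eq0 -mulr2n -scaler_nat scaler_eq0 pnatr_eq0 /=.
by move=> /eqP.
Qed.

(** * Dual isotropic subalgebras *)

Section Polarization.
Variable d : nat.
Implicit Types (e eb : 'I_d -> g) (i j r : 'I_d).

(* Projection onto the span of e along the orthogonal of the span of eb. *)
Definition proj_on e eb x : g := \sum_r form x (eb r) *: e r.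

(** [invol] and [involb] are the F-term equation (l and lbar are closed under the bracket), [dterm]
    is the D-term equation with zero divergence. *)
Record polarization e eb : Prop := Polarization {
  iso : forall i j, form (e i) (e j) = 0;
  isob : forall i j, form (eb i) (eb j) = 0;
  dual_form : forall i j, form (e i) (eb j) = (i == j)%:R;
  invol : forall i j, Pi (brk (e i) (e j)) = Pi (proj_on e eb (brk (e i) (e j)));
  involb : forall i j, Pi (brk (eb i) (eb j)) = Pi (proj_on eb e (brk (eb i) (eb j)));
  dterm : \sum_i Pi (brk (eb i) (e i)) = 0
}.

Lemma polarizationC e eb : polarization e eb -> polarization eb e.
Proof.
case=> i1 i2 df v1 v2 dt; split => //.
  by move=> i j; rewrite formC df eq_sym.
under eq_bigr do rewrite Pi_brC.
by rewrite sumrN dt oppr0.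
Qed.

Lemma proj_on_lin e eb : linear (proj_on e eb).
Proof.
move=> a x y; rewrite /proj_on scaler_sumr -big_split; apply: eq_bigr => r _ /=.
by rewrite formDl formZl scalerDl scalerA.
Qed.

Lemma proj_on_Pi e eb x y : Pi x = Pi y -> proj_on e eb x = proj_on e eb y.
Proof. by move=> E; apply: eq_bigr => r _; rewrite (form_Pi _ E). Qed.

Lemma sum_Pi_proj_on0 e eb (I : finType) (F : I -> g) :
  \sum_i Pi (F i) = 0 -> \sum_i Pi (proj_on e eb (F i)) = 0.
Proof.
rewrite -!Pi_sum -(lin_sum (proj_on_lin e eb)) -{1}Pi0 => /(proj_on_Pi e eb) ->.
by rewrite (lin0 (proj_on_lin e eb)) Pi0.
Qed.

Section Basis.
Variables (e eb : 'I_d -> g).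
Hypothesis pol : polarization e eb.

Lemma proj_on_comb (c : 'I_d -> K) : proj_on e eb (\sum_r c r *: e r) = \sum_r c r
  *: e r.
Proof.
apply: eq_bigr => r _; congr (_ *: _).
rewrite form_suml (bigD1 r) //= formZl (dual_form pol) eqxx mulr1 big1 ?addr0 //.
by move=> s sr; rewrite formZl (dual_form pol) (negPf sr) mulr0.
Qed.

Lemma proj_on_id i : proj_on e eb (e i) = e i.
Proof.
rewrite /proj_on (bigD1 i) //= (dual_form pol) eqxx scale1r big1 ?addr0 // => r ri.
by rewrite (dual_form pol) eq_sym (negPf ri) scale0r.
Qed.

Lemma proj_onK x : proj_on e eb (proj_on e eb x) = proj_on e eb x.
Proof. exact: proj_on_comb. Qed.

Lemma proj_on_eb i : proj_on e eb (eb i) = 0.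
Proof. by apply: big1 => r _; rewrite (isob pol) scale0r. Qed.

Lemma proj_on_comb_eb (c : 'I_d -> K) : proj_on e eb (\sum_r c r *: eb r) = 0.
Proof.
rewrite (lin_sum (proj_on_lin e eb)) big1 // => r _.
by rewrite (linZ (proj_on_lin e eb)) proj_on_eb scaler0.
Qed.

Lemma proj_on_invol i x : Pi (brk (e i) (proj_on e eb x)) = Pi (proj_on e eb (brk
  (e i) (proj_on e eb x))).
Proof.
rewrite {1}/proj_on Pi_br_sumr.
have -> : proj_on e eb (brk (e i) (proj_on e eb x)) =
    \sum_r form x (eb r) *: proj_on e eb (brk (e i) (e r)).
  rewrite -[RHS]/(\sum_r _) .
  under [RHS]eq_bigr do rewrite -(linZ (proj_on_lin e eb)).
  rewrite -(lin_sum (proj_on_lin e eb)); apply: proj_on_Pi.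
  by rewrite /proj_on Pi_br_sumr Pi_sum; apply: eq_bigr => r _; rewrite Pi_brZr PiZ.
rewrite Pi_sum; apply: eq_bigr => r _.
by rewrite Pi_brZr PiZ (invol pol).
Qed.

End Basis.

(** * The bracket with omega *)

Section ChargeOperator.
Variables (e eb : 'I_d -> g).
Hypothesis pol : polarization e eb.
Let polb := polarizationC pol.

(* The component of [e_i, e^j] in l + V_-. *)
Definition mixed i j := brk (e i) (eb j) - proj_on eb e (brk (e i) (eb j)).

Lemma form_mixed i j r :
  form (brk (e i) (eb j)) (e r) = - form (brk (e i) (e r)) (eb j).
Proof. by rewrite form_inv formC. Qed.

(** By invariance the sum is the pairing of x with the sum of the [e^j, e_j]. It is what would
    appear as the coefficient of lambda in [x_Lambda omega]. *)
Lemma trace_form x : \sum_j form (brk x (eb j)) (e j) = 0.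
Proof.
under eq_bigr do rewrite form_brC form_inv opprK.
have E : Pi (\sum_j brk (eb j) (e j)) = Pi 0 by rewrite Pi_sum Pi0 (dterm pol).
by rewrite -form_sumr formC (form_Pi x E) form0l.
Qed.

Definition omega : V := \sum_j quad (eb j) (e j).
Definition ad_omega x : V := \sum_j (quad (brk x (eb j)) (e j) + quad (eb j) (brk x
  (e j))).
(* +1 on l, -1 on lbar and 0 on V_-; this is - 1/k times the coefficient of chi in
   [omega_Lambda -]. *)
Definition charge x : g := proj_on e eb x - proj_on eb e x.

Lemma charge_lin : linear charge.
Proof. by move=> a x y; rewrite /charge !proj_on_lin scalerBr opprD addrACA. Qed.

Lemma charge_Pi x y : Pi x = Pi y -> charge x = charge y.
Proof. by move=> E; rewrite /charge !(proj_on_Pi _ _ E). Qed.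

(** Since [e_i, e_j] lies in l, expanding it in the basis and using invariance shows that :e^j
    [e_i, e_j]: cancels the lbar-components of the [e_i, e^j]. *)
Lemma ad_omega_e i : ad_omega (e i) = \sum_j quad (mixed i j) (e j).
Proof.
rewrite /ad_omega /mixed; under [RHS]eq_bigr do rewrite quadBl.
rewrite big_split sumrB; congr (_ + _).
under [in RHS]eq_bigr do rewrite /proj_on quad_suml.
rewrite exchange_big -sumrN; apply: eq_bigr => r _.
rewrite (quad_Pir _ (invol pol i r)) /proj_on quad_sumr -sumrN; apply: eq_bigr => j _.
by rewrite quadZr quadZl form_mixed scaleNr opprK.
Qed.

(** By the Jacobi identity and [dterm], the sum of the [[e_i, e^j], e_j] is minus that of the [e^j,
    [e_i, e_j]]. The lbar-components of the [e_i, e^j] contribute the same, by the cancellation used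
    in [ad_omega_e]. *)
Lemma trace_mixed i : \sum_j Pi (brk (mixed i j) (e j)) = 0.
Proof.
under eq_bigr do rewrite /mixed Pi_brBl.
rewrite sumrB.
have -> : \sum_j Pi (brk (brk (e i) (eb j)) (e j)) =
    - \sum_j Pi (brk (eb j) (brk (e i) (e j))).
  apply/eqP; rewrite -addr_eq0 -big_split; apply/eqP => /=.
  under eq_bigr do rewrite -Pi_jacobi.
  have E : Pi (\sum_j brk (eb j) (e j)) = Pi 0 by rewrite Pi_sum Pi0 (dterm pol).
  by rewrite -Pi_br_sumr (Pi_brr _ E) Pi_br0r.
apply/eqP; rewrite subr_eq0 eq_sym; apply/eqP.
under eq_bigr do rewrite /proj_on Pi_br_suml.
rewrite exchange_big -sumrN; apply: eq_bigr => r _.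
rewrite (Pi_brr _ (invol pol i r)) /proj_on Pi_br_sumr -sumrN; apply: eq_bigr => j _.
by rewrite Pi_brZl Pi_brZr form_mixed scaleNr.
Qed.

Lemma homog_omega : homog false omega.
Proof. by apply: homog_bigsum => i _; exact: homog_quad. Qed.

Lemma homog_ad_omega x : homog false (ad_omega x).
Proof.
by apply: homog_bigsum => i _; apply: homogD; exact: homog_quad.
Qed.

Lemma br_Pi_omega x n q : br (Pi x) omega n q = match n, q with
  | 0%N, false => ad_omega x | 0%N, true => k *: Pi (charge x) | _, _ => 0 end.
Proof.
rewrite /omega br_sumr; under eq_bigr do rewrite br_Pi_quad.
case: n q => [|[|n]] [] //; rewrite ?big1_eq //.
  by rewrite -scaler_sumr -Pi_sum sumrB.
by rewrite -scaler_suml -mulr_sumr trace_form mulr0 scale0r.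
Qed.

Lemma br_omega_Pi x n q : br omega (Pi x) n q = match n, q with
  | 0%N, false => ad_omega x - k *: S (Pi (charge x))
  | 0%N, true => - (k *: Pi (charge x)) | _, _ => 0 end.
Proof.
have big0 m s : (1 < m)%N -> br (Pi x) omega m s = 0.
  by rewrite br_Pi_omega; case: m s => [|[|m]] [].
have := br_skewsymE homog_omega (Pi_odd x) big0.
rewrite !br_Pi_omega /= expr0 !scale1r !opSV0 !addr0 subr0 oppr0 opSVZ.
by case=> E1 E2 E3 E4 E; case: n q => [|[|n]] [] //; rewrite E.
Qed.

Definition mode_omega x : V := br omega (Pi x) 0 false.

Lemma mode_omegaE x : mode_omega x = ad_omega x - k *: S (Pi (charge x)).
Proof. exact: br_omega_Pi. Qed.

Lemma homog_mode_omega x : homog false (mode_omega x).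
Proof. exact: (br_odd 0 false homog_omega (Pi_odd x)). Qed.

Lemma br_S_Pi a y n q : br (S a) (Pi y) n q = match n, q with
  | n, true => br a (Pi y) n false
  | n.+1, false => - br a (Pi y) n true
  | 0%N, false => 0 end.
Proof. by rewrite br_Sl; case: n q => [|n] []; rewrite /chiM /= ?oppr0. Qed.

Lemma br_ad_omega_Pi01 x y :
  br (ad_omega x) (Pi y) 0 true = k *: (Pi (charge (brk x y)) - Pi (brk x (charge
    y))).
Proof.
rewrite /ad_omega br_suml; under eq_bigr do rewrite brDl !br_quad_Pi -opprD -scalerDr.
rewrite sumrN -scaler_sumr -scalerN; congr (_ *: _).
have E z : form y (brk x z) = - form (brk x y) z by rewrite form_inv opprK.
under eq_bigr do rewrite !E !scaleNr opprK !PiB !PiD !PiN !PiZ.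
rewrite /charge !PiB Pi_brBr /proj_on !Pi_br_sumr !Pi_sum -!sumrB -sumrN.
apply: eq_bigr => j _; rewrite !Pi_brZr !PiZ.
rewrite !opprD !opprK [X in _ + X = _]addrC addrACA; congr (_ + _).
exact: addrC.
Qed.

(** This measures the failure of [charge] to be a derivation of the bracket of g. *)
Lemma br_mode_omega_Pi01 x y : br (mode_omega x) (Pi y) 0 true =
  k *: (Pi (charge (brk x y)) - Pi (brk x (charge y)) - Pi (brk (charge x) y)).
Proof. by rewrite mode_omegaE brBl brZl br_S_Pi br_PiE br_ad_omega_Pi01 -scalerBr.
  Qed.

Lemma br_mode_omega_Pi_true x y n : br (mode_omega x) (Pi y) n.+1 true = 0.
Proof.
rewrite mode_omegaE brBl brZl br_S_Pi br_PiE scaler0 subr0 /ad_omega br_suml big1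
  // => j _.
by rewrite brDl !br_quad_Pi; case: n => [|n]; rewrite addr0.
Qed.

Lemma S_br_mode_omega_Pi10 x y : S (br (mode_omega x) (Pi y) 1 false) = 0.
Proof.
rewrite mode_omegaE brBl brZl br_S_Pi br_PiE opSVB opSVZ opSVN opSV_scale_vac oppr0
  scaler0.
rewrite subr0 /ad_omega br_suml opSV_sum big1 // => j _.
by rewrite brDl !br_quad_Pi opSVD !opSVN !opSV_scale_vac oppr0 addr0.
Qed.

Lemma br_mode_omega_Pi_big x y n q : (1 < n)%N -> br (mode_omega x) (Pi y) n q = 0.
Proof.
case: n => [|[|n]] // _; case: q; first exact: br_mode_omega_Pi_true.
rewrite mode_omegaE brBl brZl br_S_Pi br_PiE oppr0 scaler0 subr0 /ad_omega br_suml
  big1 // => j _.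
by rewrite brDl !br_quad_Pi addr0.
Qed.

Definition omega_omega : V := br omega omega 0 false.

Lemma charge_e i : charge (e i) = e i.
Proof.
by rewrite /charge (proj_on_id pol) [X in _ - X](_ : _ = 0) ?subr0 //; apply: big1
  => r _;
   rewrite (iso pol) scale0r.
Qed.

Lemma charge_eb i : charge (eb i) = - eb i.
Proof.
rewrite /charge (proj_on_eb pol) sub0r; congr (- _); rewrite /proj_on (bigD1 i) //=.
rewrite formC (dual_form pol) eqxx scale1r big1 ?addr0 // => r ri.
by rewrite formC (dual_form pol) (negPf ri) scale0r.
Qed.

Lemma br_even_quad A x y n q : homog false A ->
  br A (quad x y) n q = nop (br A (Pi x) n q) (Pi y)
    - (-1) ^+ q *: nop (Pi x) (br A (Pi y) n q)
    + \sum_(m < n) m.+1%:R^-1 *: br (br A (Pi x) (n - m.+1)%N q) (Pi y) m true.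
Proof.
by move=> hA; rewrite (wickE _ _ _ hA (Pi_odd x)) /= andbT expr1 scaleN1r.
Qed.

Lemma trace_charge : \sum_i Pi (charge (brk (eb i) (e i))) = 0.
Proof.
under eq_bigr do rewrite /charge PiB.
by rewrite sumrB !sum_Pi_proj_on0 ?subrr // (dterm pol).
Qed.

Lemma trace_mode_omega : \sum_i br (mode_omega (eb i)) (Pi (e i)) 0 true = 0.
Proof.
under eq_bigr do rewrite br_mode_omega_Pi01 charge_e charge_eb Pi_brNl opprK subrK.
by rewrite -scaler_sumr trace_charge scaler0.
Qed.

Lemma omega_omegaE : omega_omega = \sum_i (nop (mode_omega (eb i)) (Pi (e i)) - nop
  (Pi (eb i)) (mode_omega (e i))).
Proof.
rewrite /omega_omega {2}/omega br_sumr; apply: eq_bigr => i _.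
by rewrite (br_even_quad _ _ _ _ homog_omega) big_ord0 addr0 expr0 scale1r.
Qed.

(** The charges of e^i and e_i are opposite, which kills the coefficient of chi; that of lambda is
    the trace in [trace_mode_omega]; in that of lambda chi each of the d dual pairs contributes
    k^2. *)
Lemma br_omega_omega n q : br omega omega n q = match n, q with
  | 0%N, false => omega_omega
  | 1%N, true => (d%:R * k ^+ 2) *: vac V
  | _, _ => 0 end.
Proof.
rewrite {2}/omega br_sumr.
under eq_bigr do rewrite (br_even_quad _ _ _ _ homog_omega) !br_omega_Pi charge_e
  charge_eb.
case: n q => [|n] q.
  case: q; last by rewrite omega_omegaE; apply: eq_bigr => i _; rewrite big_ord0
    addr0 expr0 scale1r !mode_omegaE charge_e charge_eb.
  apply: big1 => i _; rewrite big_ord0 addr0 expr1 scaleN1r opprK.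
  by rewrite nopNl nopNr PiN nopZl nopNl nopZr scalerN opprK subrr.
(* [omega_Lambda x] has no positive power of lambda, so only the last term of the integral
   survives. *)
have tail i : \sum_(m < n.+1) m.+1%:R^-1 *:
      br (br omega (Pi (eb i)) (n.+1 - m.+1)%N q) (Pi (e i)) m true
    = n.+1%:R^-1 *: br (br omega (Pi (eb i)) 0 q) (Pi (e i)) n true.
  rewrite big_ord_recr /= subnn big1 ?add0r // => m _.
  rewrite subSS br_omega_Pi; move: (ltn_ord m); rewrite -subn_gt0.
  by case: (n - m)%N q => [|l] [] // _; rewrite br0l scaler0.
under eq_bigr => i _.
  rewrite tail nop0l nop0r scaler0 subr0 add0r.
  over.
case: n {tail} => [|n] /=.
  rewrite invr1; under eq_bigr do rewrite scale1r.
  case: q; last exact: trace_mode_omega.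
  under eq_bigr do rewrite br_omega_Pi charge_eb PiN scalerN opprK brZl br_PiE
     formC (dual_form pol) eqxx mulr1 scalerA.
  by rewrite sumr_const card_ord -scaler_nat scalerA expr2.
case: q; apply: big1 => i _; last by rewrite -/(mode_omega _) br_mode_omega_Pi_true
  scaler0.
by rewrite br_omega_Pi brNl brZl br_PiE scaler0 oppr0 scaler0.
Qed.

Lemma charge_mixed i j : charge (mixed i j) = proj_on e eb (brk (e i) (eb j)).
Proof.
rewrite /charge !(linB (proj_on_lin _ _)) (proj_onK polb) subrr subr0.
by rewrite [proj_on e eb (proj_on eb e _)](proj_on_comb_eb pol) subr0.
Qed.

Lemma br_omega_quad01 x y : br omega (quad x y) 0 true = - (k *: (quad (charge x) y
  + quad x (charge y))).
Proof.
rewrite (br_even_quad _ _ _ _ homog_omega) big_ord0 addr0 !br_omega_Pi expr1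
  scaleN1r opprK.
by rewrite nopNl nopNr nopZl nopZr -opprD -scalerDr.
Qed.

Lemma br_omega_quad10 x y : br omega (quad x y) 1 false = br (mode_omega x) (Pi y)
  0 true.
Proof.
rewrite (br_even_quad _ _ _ _ homog_omega) big_ord1 !br_omega_Pi nop0l nop0r
  scaler0 subr0.
by rewrite add0r invr1 scale1r subnn -/(mode_omega _) -mode_omegaE.
Qed.

(** The charge 1 of the factors e_j produces a multiple of [ad_omega (e i)], which the S-term of the
    mode cancels. What is left is the extra charge of the l-component of [e_i, e^j]. *)
Lemma br_omega_mode01 i : br omega (mode_omega (e i)) 0 true =
  - (k *: \sum_j quad (proj_on e eb (brk (e i) (eb j))) (e j)).
Proof.
rewrite mode_omegaE charge_e brBr brZr.
have [_ -> _ _ _] := br_opSV_even (Pi (e i)) homog_omega.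
rewrite -/(mode_omega _) br_omega_Pi charge_e mode_omegaE charge_e ad_omega_e br_sumr.
under eq_bigr do rewrite br_omega_quad01 charge_e charge_mixed.
rewrite sumrN -scaler_sumr big_split opSVN opSVZ opprB addKr scalerN opprK.
by rewrite scalerDr opprD subrK.
Qed.

(** Of the three terms of [br_mode_omega_Pi01], two are traces that vanish by [trace_mixed], with or
    without [charge]. *)
Lemma br_omega_ad10 i : br omega (ad_omega (e i)) 1 false =
  - (k *: \sum_j Pi (brk (proj_on e eb (brk (e i) (eb j))) (e j))).
Proof.
rewrite ad_omega_e br_sumr.
under eq_bigr do rewrite br_omega_quad10 br_mode_omega_Pi01 charge_e charge_mixed.
rewrite -scaler_sumr !sumrB (trace_mixed i) subr0 -scalerN; congr (_ *: _).
under eq_bigr do rewrite /charge PiB.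
by rewrite sumrB !sum_Pi_proj_on0 ?(trace_mixed i) // subrr add0r.
Qed.

Lemma br_omega_mode10 i :
  br omega (mode_omega (e i)) 1 false = br omega (ad_omega (e i)) 1 false - k ^+ 2
    *: Pi (e i).
Proof.
rewrite mode_omegaE charge_e brBr brZr; have [_ _ -> _ _] := br_opSV_even (Pi (e
  i)) homog_omega.
by rewrite !br_omega_Pi charge_e opSV0 oppr0 add0r opprK scalerA.
Qed.

End ChargeOperator.

(** * The bracket of omega with h, and the N = 2 relations *)

Section Generators.
Variables (e eb : 'I_d -> g).
Hypothesis pol : polarization e eb.
Let polb := polarizationC pol.
(* u and v are the components in l and lbar of c i j = [e_i, e^j]. *)
Let c i j := brk (e i) (eb j).
Let u i j := proj_on e eb (c i j).
Let v i j := proj_on eb e (c i j).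

Lemma ad_omega_swap x : ad_omega eb e x = - ad_omega e eb x.
Proof.
rewrite -sumrN; apply: eq_bigr => j _.
by rewrite addrC opprD quadC [X in _ + X]quadC.
Qed.

(** Through this sign, every statement about the e_i, applied to [polb], gives its counterpart for
    the e^i. *)
Lemma omega_swap : omega eb e = - omega e eb.
Proof. by rewrite -sumrN; apply: eq_bigr => j _; rewrite quadC. Qed.

Lemma mode_omega_swap x : mode_omega eb e x = - mode_omega e eb x.
Proof. by rewrite /mode_omega omega_swap brNl. Qed.

Lemma proj_on_swap (a b : 'I_d -> g) i j :
  proj_on a b (brk (eb i) (e j)) = - proj_on a b (brk (e j) (eb i)).
Proof.
rewrite -(linN (proj_on_lin a b)); apply: proj_on_Pi.
by rewrite PiN Pi_brC.
Qed.

Lemma Pi_mixed_swap i j : Pi (mixed eb e i j) = - Pi (c j i - u j i).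
Proof. by rewrite /mixed proj_on_swap !PiB !PiN Pi_brC opprK opprB addrC. Qed.

Lemma ad_omega_eb i : ad_omega e eb (eb i) = \sum_j quad (c j i - u j i) (eb j).
Proof.
have := ad_omega_e polb i; rewrite ad_omega_swap => /eqP; rewrite eqr_oppLR => /eqP
  ->.
rewrite -sumrN; apply: eq_bigr => j _.
by rewrite /quad Pi_mixed_swap nopNl opprK.
Qed.

Lemma br_omega_modeb01 i :
  br (omega e eb) (mode_omega e eb (eb i)) 0 true = k *: \sum_j quad (v j i) (eb j).
Proof.
have := br_omega_mode01 polb i; rewrite omega_swap mode_omega_swap brNl brNr opprK
  => ->.
rewrite -scalerN -sumrN; congr (_ *: _); apply: eq_bigr => j _.
by rewrite proj_on_swap quadNl opprK.
Qed.

Lemma br_omega_adb10 i : br (omega e eb) (ad_omega e eb (eb i)) 1 false =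
  - (k *: \sum_j Pi (brk (proj_on eb e (brk (eb i) (e j))) (eb j))).
Proof. by have := br_omega_ad10 polb i; rewrite omega_swap ad_omega_swap brNl brNr
  opprK. Qed.

Lemma br_omega_modeb10 i : br (omega e eb) (mode_omega e eb (eb i)) 1 false =
  br (omega e eb) (ad_omega e eb (eb i)) 1 false - k ^+ 2 *: Pi (eb i).
Proof.
by have := br_omega_mode10 polb i; rewrite omega_swap mode_omega_swap ad_omega_swap
  !brNl !brNr !opprK.
Qed.

Lemma trace_mixed_swap j : \sum_i Pi (brk (eb i) (c i j - u i j)) = 0.
Proof.
rewrite -[RHS](trace_mixed polb j); apply: eq_bigr => i _.
have E : Pi (mixed eb e j i) = Pi (- (c i j - u i j)) by rewrite PiN Pi_mixed_swap.
by rewrite (Pi_brl _ E) Pi_brNl Pi_brC.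
Qed.

Lemma nop_even_Pi A x : homog false A -> (forall n, br A (Pi x) n.+1 true = 0) ->
  nop A (Pi x) = nop (Pi x) A + S (S (br A (Pi x) 0 true)).
Proof.
move=> hA A0; have := nop_quasicomm hA (Pi_odd x).
rewrite (int_nabla_linear (opSV0 V) A0) expr0 scale1r => /eqP.
by rewrite subr_eq addrC => /eqP.
Qed.

Lemma form_u i j r : form (u i j) (e r) = 0.
Proof.
by rewrite form_suml big1 // => s _; rewrite formZl (iso pol) mulr0.
Qed.

Lemma form_c i j r : form (c i j) (e r) = form (v i j) (e r).
Proof.
rewrite /v /proj_on form_suml (bigD1 r) //= formZl (dual_form polb) eqxx mulr1 big1
  ?addr0 //.
by move=> s sr; rewrite formZl (dual_form polb) (negPf sr) mulr0.
Qed.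

Lemma trace_minus : \sum_i Pi (c i i - u i i - v i i) = 0.
Proof.
have dt := dterm polb.
under eq_bigr do rewrite !PiB.
by rewrite !sumrB dt !sum_Pi_proj_on0 // !subr0.
Qed.

(* These are the terms of h whose charges do not match S omega. *)
Lemma trace_nop_minus :
  \sum_i nop (\sum_j quad (c j i - u j i - v j i) (eb j)) (Pi (e i))
  + \sum_i nop (Pi (eb i)) (\sum_j quad (c i j - u i j - v i j) (e j)) = 0.
Proof.
(* Each reordering costs T of a multiple of the V_- component of [e_i, e^i]; these sum to zero by
   [trace_minus]. *)
have -> : \sum_i nop (\sum_j quad (c j i - u j i - v j i) (eb j)) (Pi (e i)) =
   \sum_i nop (Pi (e i)) (\sum_j quad (c j i - u j i - v j i) (eb j)).
  rewrite (eq_bigr (fun i => nop (Pi (e i)) (\sum_j quad (c j i - u j i - v j i)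
    (eb j))
    + S (S (k *: Pi (c i i - u i i - v i i))))) => [|i _].
    rewrite big_split /= -!opSV_sum -scaler_sumr trace_minus scaler0 !opSV0.
    by rewrite addr0.
  rewrite nop_even_Pi => [||n].
  - congr (_ + S (S _)); rewrite br_suml (bigD1 i) //= big1 ?addr0 => [|j ji].
      rewrite br_quad_Pi (dual_form pol) eqxx scale1r formC !formBl form_c form_u
        subr0 subrr.
      by rewrite scale0r sub0r PiN scalerN opprK.
    rewrite br_quad_Pi (dual_form pol) eq_sym (negPf ji) scale0r formC !formBl form_c.
    by rewrite form_u !subr0 subrr scale0r Pi0 scaler0 oppr0.
  - by apply: homog_bigsum => j _; exact: homog_quad.
  - by rewrite br_suml big1 // => j _; rewrite br_quad_Pi; case: n.
(* Once the indices of one sum are exchanged, the two sums differ by a transposition of e_i and e^j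
   in a cubic product that is antisymmetric by [nop3C] and [quadC]. *)
rewrite -big_split /=.
under eq_bigr do rewrite !nop_sumr.
rewrite big_split /= [X in _ + X]exchange_big -big_split big1 //= => i _.
rewrite -big_split big1 //= => j _.
by rewrite nop3C [X in _ + X]nop3C [quad (eb j) _]quadC nopNr opprK addNr.
Qed.

Local Notation omega := (omega e eb).
Local Notation ad_omega := (ad_omega e eb).
Local Notation mode_omega := (mode_omega e eb).
Local Notation omega_omega := (omega_omega e eb).

Lemma mode_omega_e i : mode_omega (e i) = ad_omega (e i) - k *: S (Pi (e i)).
Proof. by rewrite mode_omegaE // (charge_e pol). Qed.

Lemma mode_omega_eb i : mode_omega (eb i) = ad_omega (eb i) + k *: S (Pi (eb i)).
Proof. by rewrite mode_omegaE // (charge_eb pol) PiN opSVN scalerN opprK. Qed.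

Lemma opSV_omega : S omega = \sum_i (nop (S (Pi (eb i))) (Pi (e i))
                              - nop (Pi (eb i)) (S (Pi (e i)))).
Proof.
rewrite opSV_sum; apply: eq_bigr => i _.
by rewrite (nop_S _ (Pi_odd (eb i))) expr1 scaleN1r.
Qed.

Lemma br_omega_omega_omega01 : br omega omega_omega 0 true = - (k ^+ 2 *: S omega).
Proof.
rewrite omega_omegaE br_sumr opSV_omega scaler_sumr -sumrN.
(* For each i the l- and lbar-components are balanced; besides S omega, only the V_- components c -
   u - v remain, and they vanish after summation. *)
rewrite (eq_bigr (fun i => - (k *: (nop (\sum_j quad (c j i - u j i - v j i) (eb
  j)) (Pi (e i))
    + nop (Pi (eb i)) (\sum_j quad (c i j - u i j - v i j) (e j))))
    - (k ^+ 2 *: (nop (S (Pi (eb i))) (Pi (e i)) - nop (Pi (eb i)) (S (Pi (e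
      i))))))) => [|i _].
  rewrite big_split /= sumrN -scaler_sumr big_split /= trace_nop_minus.
  by rewrite scaler0 oppr0 add0r.
rewrite brBr (wick01 _ (homog_omega _ _) (homog_mode_omega _ _ _)).
rewrite (wick01 _ (homog_omega _ _) (Pi_odd _)) br_omega_modeb01 (br_omega_mode01
  pol).
rewrite !(br_omega_Pi pol) (charge_e pol) (charge_eb pol) mode_omega_e mode_omega_eb.
have -> : \sum_j quad (c j i - u j i - v j i) (eb j) = ad_omega (eb i) - \sum_j
  quad (v j i) (eb j).
  by rewrite ad_omega_eb -sumrB; apply: eq_bigr => j _; rewrite quadBl.
have -> : \sum_j quad (c i j - u i j - v i j) (e j) = ad_omega (e i) - \sum_j quad
  (u i j) (e j).
  by rewrite (ad_omega_e pol) -sumrB; apply: eq_bigr => j _; rewrite -quadBl addrAC.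
rewrite -[\sum_j quad (proj_on e eb (brk (e i) (eb j))) (e j)]/(\sum_j quad (u i j)
  (e j)).
rewrite PiN scalerN opprK !nopNr !nopDl !nopDr !nopNl !nopNr !nopZl !nopZr.
rewrite !scalerA -expr2 !scalerDr !scalerN !opprD !opprK !addrA.
by rewrite [LHS](ACl ((2*1)*(4*6)*(3*5))%AC) /= !addrA.
Qed.

Lemma form_swap23 x y z : form (brk x y) z = - form (brk x z) y.
Proof. by rewrite form_inv formC. Qed.

Lemma form_swap13 x y z : form (brk x y) z = - form (brk z y) x.
Proof. by rewrite form_brC form_swap23 opprK form_brC. Qed.

(** Both sides contract two structure constants ([x, y]|z) against :e^s e_i:, and total antisymmetry
    identifies the coefficients [f]. *)
Lemma sum_br_omega_ad10 : \sum_i nop (br omega (ad_omega (eb i)) 1 false) (Pi (e i)) =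
  \sum_i nop (Pi (eb i)) (br omega (ad_omega (e i)) 1 false).
Proof.
under eq_bigr do rewrite br_omega_adb10 nopNl nopZl nop_suml.
under [RHS]eq_bigr do rewrite (br_omega_ad10 pol) nopNr nopZr nop_sumr.
rewrite !sumrN -!scaler_sumr; congr (- (_ *: _)).
pose f i j r s := form (brk (eb i) (e j)) (e r) * form (brk (eb r) (eb j)) (e s).
transitivity (\sum_i \sum_j \sum_r \sum_s f i j r s *: quad (eb s) (e i)).
  apply: eq_bigr => i _; apply: eq_bigr => j _.
  rewrite {1}/proj_on Pi_br_suml nop_suml; apply: eq_bigr => r _.
  rewrite Pi_brZl (involb pol) nopZl {1}/proj_on Pi_sum nop_suml scaler_sumr.
  by apply: eq_bigr => s _; rewrite PiZ nopZl scalerA.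
transitivity (\sum_s \sum_j \sum_r \sum_i f i j r s *: quad (eb s) (e i)).
  under eq_bigr do under eq_bigr do rewrite exchange_big /=.
  under eq_bigr do rewrite exchange_big /=.
  rewrite exchange_big /=; apply: eq_bigr => s _.
  rewrite exchange_big /=; apply: eq_bigr => j _.
  by rewrite exchange_big.
apply: eq_bigr => s _; apply: eq_bigr => j _.
rewrite {1}/proj_on Pi_br_suml nop_sumr; apply: eq_bigr => r _.
rewrite Pi_brZl (invol pol) nopZr {1}/proj_on Pi_sum nop_sumr scaler_sumr.
apply: eq_bigr => i _; rewrite PiZ nopZr scalerA; congr (_ *: _).
by rewrite /f form_swap13 [X in _ * X]form_swap13 mulrNN mulrC.
Qed.

(** The trace of a product of matrices with entries in g. It is antisymmetric because [quad] is, so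
    the pairing of a matrix with itself vanishes. *)
Definition pairing (A B : 'I_d -> 'I_d -> g) : V := \sum_i \sum_j quad (A i j) (B j
  i).

Lemma pairingC A B : pairing A B = - pairing B A.
Proof.
rewrite /pairing exchange_big -sumrN; apply: eq_bigr => i _.
by rewrite -sumrN; apply: eq_bigr => j _; rewrite quadC.
Qed.

Lemma pairingBl A A' B :
  pairing (fun i j => A i j - A' i j) B = pairing A B - pairing A' B.
Proof.
rewrite -sumrB; apply: eq_bigr => i _; rewrite -sumrB.
by apply: eq_bigr => j _; rewrite quadBl.
Qed.

Lemma pairingBr A B B' :
  pairing A (fun i j => B i j - B' i j) = pairing A B - pairing A B'.
Proof.
rewrite -sumrB; apply: eq_bigr => i _; rewrite -sumrB.
by apply: eq_bigr => j _; rewrite quadBr.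
Qed.

(** Expanding u i j in the e_r turns [e^i, u i j] into a combination of the c r i, on which [charge]
    is u - v; invariance reassembles the coefficients into u i r. *)
Lemma sum_quad_charge :
  \sum_i \sum_j nop (Pi (charge e eb (brk (eb i) (u i j)))) (Pi (e j)) =
  pairing (fun i j => u i j - v i j) u.
Proof.
have E i j : charge e eb (brk (eb i) (u i j)) =
    \sum_r form (c i r) (eb j) *: charge e eb (c r i).
  under eq_bigr do rewrite -(linZ (charge_lin _ _)).
  rewrite -(lin_sum (charge_lin _ _)); apply: charge_Pi.
  rewrite {1}/u /proj_on Pi_br_sumr Pi_sum; apply: eq_bigr => r _.
  by rewrite Pi_brZr PiZ form_swap23 Pi_brC scalerN scaleNr opprK.
under eq_bigr do under eq_bigr do rewrite E Pi_sum nop_suml.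
rewrite /pairing [RHS]exchange_big; apply: eq_bigr => i _.
rewrite exchange_big; apply: eq_bigr => r _ /=.
rewrite [u i r]/u /proj_on quad_sumr; apply: eq_bigr => j _.
by rewrite quadZr PiZ nopZl.
Qed.

Lemma sum_quad_br_e : \sum_i \sum_j quad (brk (e i) (v j i)) (eb j) = - pairing c v.
Proof.
rewrite /pairing -sumrN; apply: eq_bigr => i _; rewrite -sumrN.
under eq_bigr => j _.
  rewrite (quad_Pil _ (_ : _ = Pi (\sum_r form (c j i) (e r) *: c i r))); last first.
    rewrite {1}/v /proj_on Pi_br_sumr Pi_sum.
    by apply: eq_bigr => r _; rewrite Pi_brZr PiZ.
  rewrite quad_suml; over.
rewrite exchange_big; apply: eq_bigr => r _ /=.
rewrite [v r i]/v /proj_on quad_sumr -sumrN; apply: eq_bigr => j _.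
rewrite quadZl quadZr -scaleNr; congr (_ *: _).
exact: form_swap13.
Qed.

Lemma sum_Pi_e j : \sum_i Pi (brk (e i) (c j i - u j i)) =
  \sum_i Pi (brk (e i) (v j i)) + \sum_i Pi (brk (u j i) (e i)).
Proof.
apply/eqP; rewrite -subr_eq0 -big_split -sumrB /=; apply/eqP.
rewrite -[RHS]oppr0 -[in RHS](trace_mixed pol j) -sumrN; apply: eq_bigr => i _.
rewrite !Pi_brBr Pi_brBl [Pi (brk (u j i) _)]Pi_brC.
rewrite [Pi (brk (brk _ _) _)]Pi_brC [Pi (brk (proj_on _ _ _) _)]Pi_brC.
by rewrite -[v j i]/(proj_on eb e (brk (e j) (eb i))) !opprD !opprK addrACA addNr
  addr0.
Qed.

(** These are the sums that arise in [sum_br_modeb_mode]. All but the right side reduce to pairings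
    of c, u and v, which cancel by antisymmetry. *)
Lemma sum_quad_traces :
  \sum_i \sum_j nop (Pi (charge e eb (brk (eb i) (u i j)))) (Pi (e j))
  - pairing (fun i j => c i j - v i j) (fun i j => u i j - v i j)
  + \sum_i \sum_j quad (brk (e i) (c j i - u j i)) (eb j)
  + pairing (fun i j => c i j - u i j) c
  = \sum_j nop (\sum_i Pi (brk (u j i) (e i))) (Pi (eb j)).
Proof.
have -> : \sum_i \sum_j quad (brk (e i) (c j i - u j i)) (eb j) =
    - pairing c v + \sum_j nop (\sum_i Pi (brk (u j i) (e i))) (Pi (eb j)).
  rewrite -sum_quad_br_e exchange_big [X in X + _]exchange_big -big_split.
  apply: eq_bigr => j _ /=; rewrite -!nop_suml -nopDl sum_Pi_e.
  by [].
rewrite sum_quad_charge !pairingBl !pairingBr.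
have pairing0 A : pairing A A = 0 by exact: sum_quad_sym0.
rewrite !pairing0 (pairingC u c); set t := \sum_j _.
move: (pairing v u) (pairing c u) (pairing c v) t => a b x t.
rewrite !(subr0, sub0r) !opprD !opprK !addrA.
by rewrite [LHS](ACl (6*(1*4)*(3*5)*(2*7))%AC) /= !(addNr, addrN) !addr0.
Qed.

(** [mixed] is split as (c - u) - v + u. The first part gives traces that vanish; on the second,
    [e^i, v] stays in lbar and has charge -1, which cancels it; of the third, only the charge of
    [e^i, u] is left. *)
Lemma sum_br_modeb_mixed j : \sum_i br (mode_omega (eb i)) (Pi (mixed e eb i j)) 0
  true =
  k *: \sum_i Pi (charge e eb (brk (eb i) (u i j))).
Proof.
have Pi_charge_lin x : linear (fun y => Pi (charge e eb (brk x y))).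
  move=> a y y'; rewrite -PiZ -PiD -charge_lin; congr Pi; apply: charge_Pi.
  by rewrite PiD PiZ Pi_br_lin_r.
have Nv i : Pi (charge e eb (brk (eb i) (v i j))) = - Pi (brk (eb i) (v i j)).
  have E := proj_on_invol polb i (c i j).
  by rewrite (charge_Pi _ _ E) /charge (proj_onK polb) (proj_on_comb_eb pol) sub0r
    PiN E.
have q0 := trace_mixed_swap j.
have Nq0 : \sum_i Pi (charge e eb (brk (eb i) (c i j - u i j))) = 0.
  by under eq_bigr do rewrite /charge PiB; rewrite sumrB !(sum_Pi_proj_on0 _ _ q0)
    subrr.
transitivity (\sum_i k *: (Pi (charge e eb (brk (eb i) (c i j - u i j)))
    + Pi (brk (eb i) (c i j - u i j)) + Pi (charge e eb (brk (eb i) (u i j)))));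
      last first.
  by rewrite -scaler_sumr !big_split /= q0 Nq0 !add0r.
apply: eq_bigr => i _; rewrite br_mode_omega_Pi01 // (charge_eb pol) (charge_mixed
  pol) Pi_brNl; congr (_ *: _).
rewrite -[proj_on e eb (brk _ _)]/(u i j).
have -> : mixed e eb i j = c i j - u i j - v i j + u i j by rewrite addrAC subrK.
rewrite (linD (Pi_charge_lin _)) (linB (Pi_charge_lin _)) Nv opprK Pi_brDr Pi_brBr.
rewrite opprK !addrA [LHS](ACl ((1*5*3)*(2*6)*(4*7))%AC) /=.
by rewrite addrN addNr !addr0.
Qed.

(** By skew-symmetry the two arguments may be exchanged: the correction is S of the vanishing trace
    [trace_mode_omega]. In the new order [br_Pi_quad] applies. *)
Lemma sum_br_modeb_e00 : \sum_i br (mode_omega (eb i)) (Pi (e i)) 0 false =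
  \sum_i \sum_j (quad (brk (e i) (c j i - u j i)) (eb j) + quad (c j i - u j i) (c
    i j)).
Proof.
transitivity (\sum_i br (Pi (e i)) (mode_omega (eb i)) 0 false).
  apply/eqP; rewrite eq_sym -subr_eq0 -sumrB; apply/eqP.
  transitivity (\sum_i - S (br (mode_omega (eb i)) (Pi (e i)) 0 true)); last first.
    by rewrite sumrN -opSV_sum (trace_mode_omega pol) opSV0 oppr0.
  apply: eq_bigr => i _; have big := @br_mode_omega_Pi_big _ _ pol (eb i) (e i).
  have [-> _ _ _ _] := br_skewsymE (Pi_odd (e i)) (homog_mode_omega e eb (eb i)) big.
  rewrite andbF expr0 scale1r (S_br_mode_omega_Pi10 pol) opSV0 subr0
    (br_mode_omega_Pi_true pol) !opSV0 addr0.
  by rewrite addrAC subrr add0r.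
under eq_bigr do rewrite mode_omega_eb brDr brZr ad_omega_eb br_sumr.
rewrite big_split /= -scaler_sumr [X in _ + _ *: X](_ : _ = 0).
  rewrite scaler0 addr0; apply: eq_bigr => i _; apply: eq_bigr => j _.
  by rewrite br_Pi_quad.
transitivity (\sum_i S (Pi (brk (e i) (eb i)))); last first.
  by rewrite -opSV_sum (dterm polb) opSV0.
apply: eq_bigr => i _; by have [-> _ _] := br_opSV_odd (Pi (eb i)) (Pi_odd (e i));
  rewrite br_PiE.
Qed.

(** It makes the double brackets in the coefficient of lambda of [omega_Lambda h] cancel against the
    products. *)
Lemma sum_br_modeb_mode : \sum_i br (mode_omega (eb i)) (mode_omega (e i)) 0 true =
  \sum_i nop (Pi (eb i)) (br omega (ad_omega (e i)) 1 false).
Proof.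
transitivity (k *: (\sum_i \sum_j nop (Pi (charge e eb (brk (eb i) (u i j)))) (Pi
  (e j))
  - pairing (fun i j => c i j - v i j) (fun i j => u i j - v i j)
  + (\sum_i \sum_j quad (brk (e i) (c j i - u j i)) (eb j)
  + pairing (fun i j => c i j - u i j) c))).
  transitivity (\sum_i (\sum_j nop (br (mode_omega (eb i)) (Pi (mixed e eb i j)) 0
    true) (Pi (e j))
     - \sum_j k *: quad (c i j - v i j) (u j i - v j i)
     - k *: S (br (mode_omega (eb i)) (Pi (e i)) 0 true)
     + k *: br (mode_omega (eb i)) (Pi (e i)) 0 false)).
    apply: eq_bigr => i _; rewrite mode_omega_e brBr brZr (ad_omega_e pol) br_sumr.
    have [_ -> _ _ _] := br_opSV_even (Pi (e i)) (homog_mode_omega e eb (eb i)).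
    rewrite scalerBr opprB addrA addrAC; congr (_ - _ + _).
    rewrite -sumrB; apply: eq_bigr => j _.
    rewrite (wick01 _ (homog_mode_omega _ _ _) (Pi_odd _)).
    rewrite [br _ (Pi (e j)) _ _](br_mode_omega_Pi01 pol) (charge_e pol) (charge_eb
      pol).
    rewrite Pi_brNl opprK subrK /charge !proj_on_swap -opprD PiN scalerN nopNr nopZr.
    by [].
  rewrite big_split /= !sumrB -!scaler_sumr -opSV_sum (trace_mode_omega pol) opSV0
    scaler0.
  rewrite subr0 sum_br_modeb_e00 [X in X - _]exchange_big /=.
  under eq_bigr do rewrite -nop_suml sum_br_modeb_mixed nopZl nop_suml.
  rewrite -!scaler_sumr exchange_big /=.
  under [X in _ - X]eq_bigr do rewrite -scaler_sumr.
  rewrite -!scaler_sumr -scalerBr -scalerDr; congr (_ *: (_ - _ + _)).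
  under eq_bigr do rewrite big_split.
  rewrite big_split /=; congr (_ + _).
  by rewrite /pairing exchange_big.
rewrite addrA sum_quad_traces scaler_sumr; apply: eq_bigr => j _.
rewrite (br_omega_ad10 pol) nopNr nopZr -scalerN; congr (_ *: _).
rewrite nop_sumr nop_suml -sumrN; apply: eq_bigr => i _.
exact: quadC.
Qed.

Lemma br_omega_omega_omega10 : br omega omega_omega 1 false = - (2 *: (k ^+ 2 *:
  omega)).
Proof.
rewrite omega_omegaE br_sumr.
transitivity (\sum_i (nop (br omega (mode_omega (eb i)) 1 false) (Pi (e i))
   + nop (Pi (eb i)) (br omega (mode_omega (e i)) 1 false)
   + (br (br omega (mode_omega (eb i)) 0 false) (Pi (e i)) 0 true
      - br (mode_omega (eb i)) (mode_omega (e i)) 0 true))).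
  apply: eq_bigr => i _.
  rewrite brBr (wick10 _ (homog_omega _ _) (homog_mode_omega _ _ _)).
  rewrite (wick10 _ (homog_omega _ _) (Pi_odd _)) !(br_omega_Pi pol).
  rewrite nop0l nop0r scaler0 addr0 add0r expr1 scaleN1r opprD opprK.
  by rewrite addrACA addrA -(mode_omegaE pol) -addrA.
(* The nested bracket from the Wick integral is rewritten with omega acting as a derivation. The
   outer action falls on a vanishing trace, and a second copy of the bracket of the two modes
   appears. *)
have mode i : br (br omega (mode_omega (eb i)) 0 false) (Pi (e i)) 0 true =
    br omega (br (mode_omega (eb i)) (Pi (e i)) 0 true) 0 false - br (mode_omega
      (eb i)) (mode_omega (e i)) 0 true.
  have := jacobi_mode (Pi (e i)) 0 true (homog_omega e eb) (homog_mode_omega e eb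
    (eb i)).
  rewrite /= !expr1 !scaleN1r => /eqP.
  by rewrite -opprD eqr_opp => /eqP ->; rewrite addrK.
under eq_bigr do rewrite mode.
rewrite !big_split /= sumrN -br_sumr (trace_mode_omega pol) br0r sub0r.
under eq_bigr do rewrite br_omega_modeb10 nopBl nopZl.
under [X in _ + X + _]eq_bigr do rewrite (br_omega_mode10 pol) nopBr nopZr.
rewrite !sumrB sum_br_omega_ad10 sum_br_modeb_mode -!scaler_sumr.
rewrite -[\sum_i nop (Pi (eb i)) (Pi (e i))]/omega scaler_nat mulr2n opprD !addrA.
by rewrite [LHS](ACl ((1*5)*(3*6)*(2*4))%AC) /= !addrN !add0r.
Qed.

Lemma homog_omega_omega : homog true omega_omega.
Proof. exact: (br_odd 0 false (homog_omega e eb) (homog_omega e eb)). Qed.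

(** The shape of k^2 H' when w = 0. Putting e_i on the left of S e^i and of [ad_omega (eb i)] costs
    T of traces that vanish by [dterm]. *)
Lemma omega_omega_explicit : omega_omega =
  k *: \sum_j (nop (Pi (e j)) (S (Pi (eb j))) + nop (Pi (eb j)) (S (Pi (e j))))
  + \sum_j \sum_r
      (nop (Pi (e j)) (quad (eb r) (brk (eb j) (e r)))
       + nop (Pi (eb j)) (quad (e r) (brk (e j) (eb r)))
       - nop (Pi (e j)) (quad (e r) (brk (eb j) (eb r)))
       - nop (Pi (eb j)) (quad (eb r) (brk (e j) (e r)))).
Proof.
have commS : \sum_i nop (S (Pi (eb i))) (Pi (e i)) =
    \sum_i nop (Pi (e i)) (S (Pi (eb i))).
  transitivity (\sum_i (nop (Pi (e i)) (S (Pi (eb i))) + S (S (Pi (brk (eb i) (e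
    i)))))).
    apply: eq_bigr => i _; rewrite nop_even_Pi ?br_S_Pi ?br_PiE //.
      exact: (opSV_odd (Pi_odd _)).
    by move=> n; rewrite br_S_Pi br_PiE.
  by rewrite big_split /= -!opSV_sum (dterm pol) !opSV0 addr0.
have commQ : \sum_i nop (ad_omega (eb i)) (Pi (e i)) = \sum_i nop (Pi (e i))
  (ad_omega (eb i)).
  transitivity (\sum_i (nop (Pi (e i)) (ad_omega (eb i))
      + S (S (k *: (Pi (charge e eb (brk (eb i) (e i))) - Pi (brk (eb i) (e i))))))).
    apply: eq_bigr => i _; rewrite nop_even_Pi => [||n].
    - by rewrite br_ad_omega_Pi01 (charge_e pol).
    - exact: homog_ad_omega.
    - by rewrite br_suml big1 // => j _; rewrite brDl !br_quad_Pi; case: n => [|n];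
      rewrite addr0.
  rewrite big_split /= -!opSV_sum -scaler_sumr sumrB (trace_charge pol) (dterm pol).
  by rewrite subrr scaler0 !opSV0 addr0.
rewrite omega_omegaE.
under eq_bigr do rewrite mode_omega_eb mode_omega_e nopDl nopBr nopZl nopZr opprB.
rewrite !big_split /= sumrN -!scaler_sumr commS commQ scalerDr !addrA.
rewrite [LHS](ACl ((2*3)*(1*4))%AC) /= -sumrB; congr (_ + _).
apply: eq_bigr => i _; rewrite !nop_sumr -sumrB; apply: eq_bigr => j _.
rewrite !nopDr [quad (brk (eb i) (eb j)) _]quadC [quad (brk (e i) (eb j)) _]quadC
  !nopNr.
by rewrite opprD opprK !addrA [LHS](ACl (2*3*1*4)%AC).
Qed.

(** The factor [ii] supplies the sign in [J_Lambda J] = -(H + ...). The coefficient d k^2 of lambda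
    chi, divided by k^2, must be c / 3, whence c = 3 d. *)
Lemma N2_pair_polarization (ii : K) : ii ^+ 2 = -1 ->
  N2_pair (3 * d%:R) ((ii / k) *: omega) (k ^- 2 *: omega_omega).
Proof.
move=> ii2.
have iik : (ii / k) ^+ 2 = - k ^- 2 by rewrite expr_div_n ii2 mulN1r.
have c3 : 3 * d%:R / 3 = d%:R :> K by rewrite mulrC mulKf // pnatr_eq0.
have k2 : k ^- 2 * k ^+ 2 = 1 by rewrite mulVf // expf_neq0.
have hJ : homog false ((ii / k) *: omega) by apply: homogZ; exact: homog_omega.
have hH : homog true (k ^- 2 *: omega_omega) by apply: homogZ; exact:
  homog_omega_omega.
split => //; apply: N2_relations_of_JJ => //.
- apply/funext => n; apply/funext => q.
  change (br ((ii / k) *: omega) ((ii / k) *: omega) n q = - (pconst (k ^- 2 *: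
    omega_omega) n q +
    (3 * d%:R / 3) *: lamM (chiM (pconst (vac V))) n q)).
  rewrite brZl brZr scalerA -expr2 iik c3 (br_omega_omega pol) scaleNr.
  case: n q => [|[|[|n]]] [] /=; rewrite /pconst /lamM /chiM /lamM /= ?(scaler0,
    addr0, add0r, oppr0) //.
  rewrite scalerA mulrCA mulVf ?mulr1 // expf_neq0 //.
- by rewrite brZl brZr br_omega_omega_omega01 opSVZ !scalerN !scalerA -mulrA k2 mulr1.
- rewrite brZl brZr br_omega_omega_omega10 !scalerN !scalerA; congr (- (_ *: _)).
  by rewrite mulrCA -[_ * k ^+ 2]mulrA k2 mulr1.
Qed.

End Generators.
End Polarization.

End Superaffine.

(** * The quadratic Lie algebras g_(m,n,p) *)

Section ComplexBracket.
Variables (R : rcfType) (W : lmodType R) (f : W -> W -> W).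
Hypotheses (fl : forall y, linear (f^~ y)) (fC : forall x y, f x y = - f y x).

Lemma cplx_brkC (a b : cplx W) : cplx_brk f a b = - cplx_brk f b a.
Proof.
rewrite /cplx_brk; congr (_, _) => /=.
  by rewrite [f a.1 _]fC [f a.2 _]fC -opprD.
by rewrite [f a.1 _]fC [f a.2 _]fC -opprD addrC.
Qed.

Lemma cplx_brk_linl (b : cplx W) : linear (fun a => cplx_brk f a b).
Proof.
move=> z a a'; rewrite /cplx_brk; congr (_, _) => /=.
  rewrite !(linD (fl _)) (linN (fl _)) !(linZ (fl _)) !scalerBr !scalerDr !opprD.
  rewrite !addrA [LHS](ACl (1*4*5*2*3*6)%AC) /=.
  by [].
rewrite !(linD (fl _)) (linN (fl _)) !(linZ (fl _)) !scalerBr !scalerDr.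
by rewrite !addrA [LHS](ACl (1*4*5*2*3*6)%AC) /=.
Qed.

Lemma cplx_brk_linr (a : cplx W) : linear (cplx_brk f a).
Proof.
by move=> z b b'; rewrite cplx_brkC cplx_brk_linl opprD -scalerN -!cplx_brkC.
Qed.

End ComplexBracket.

(** * Coordinates on the Heisenberg algebra *)

Section Coordinates.
Variable R : realType.
Implicit Types b u v w x y z : 'rV[R]_6.

Lemma ord6_ind (P : 'I_6 -> Prop) :
  P (inord 0) -> P (inord 1) -> P (inord 2) -> P (inord 3) -> P (inord 4) ->
  P (inord 5) -> forall i, P i.
Proof.
move=> P0 P1 P2 P3 P4 P5 i; rewrite -(inord_val i).
by case: i => [[|[|[|[|[|[|i]]]]]] Hi] //=.
Qed.

Lemma row6P v w : (forall i, (0 < i < 7)%N -> dual i v = dual i w) -> v = w.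
Proof.
move=> E; apply/rowP; apply: ord6_ind.
- exact: (E 1%N).
- exact: (E 2).
- exact: (E 3).
- exact: (E 4).
- exact: (E 5).
- exact: (E 6).
Qed.

Lemma evE v w : ev v w = dual 1 v * dual 1 w + dual 2 v * dual 2 w
  + dual 3 v * dual 3 w + dual 4 v * dual 4 w + dual 5 v * dual 5 w + dual 6 v *
    dual 6 w.
Proof.
rewrite /ev /dual !big_ord_recl big_ord0 addr0 !addrA.
have o i (Hi : (i < 6)%N) : Ordinal Hi = inord i by apply/val_inj; rewrite /= inordK.
by do !congr (_ + _); congr (v _ _ * w _ _); apply/val_inj; rewrite /= inordK.
Qed.

Lemma dualD i v w : dual i (v + w) = dual i v + dual i w.
Proof. by rewrite /dual mxE. Qed.
Lemma dualN i v : dual i (- v) = - dual i v.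
Proof. by rewrite /dual mxE. Qed.
Lemma dualZ i a v : dual i (a *: v) = a * dual i v.
Proof. by rewrite /dual mxE. Qed.

Lemma dual_delta i j : (0 < i < 7)%N -> (j < 6)%N ->
  dual i (delta_mx 0 (inord j) : 'rV[R]_6) = (i == j.+1)%:R.
Proof.
move=> /andP[i0 i6] j6; rewrite /dual mxE eqxx /=; congr (_ %:R).
case: i i0 i6 => // i _ i6 /=; rewrite eqSS; congr nat_of_bool.
by apply/eqP/eqP => [/(congr1 val)|->//]; rewrite /= !inordK.
Qed.

Lemma dual_hI v : (dual 1 (hI v) = - dual 2 v) * (dual 2 (hI v) = dual 1 v)
  * (dual 3 (hI v) = - dual 4 v) * (dual 4 (hI v) = dual 3 v)
  * (dual 5 (hI v) = - dual 6 v) * (dual 6 (hI v) = dual 5 v).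
Proof. by rewrite /dual /hI !mxE /= !inordK. Qed.

Lemma dual_hbr v w : (dual 1 (hbr v w) = 0) * (dual 2 (hbr v w) = 0)
  * (dual 3 (hbr v w) = 0) * (dual 4 (hbr v w) = 0)
  * (dual 5 (hbr v w) = - d5 v w) * (dual 6 (hbr v w) = - d6 v w).
Proof.
rewrite /hbr; do !split; rewrite dualN dualD !dualZ !dual_delta //=;
by rewrite ?(mulr0, mulr1, addr0, add0r, oppr0).
Qed.

Lemma ev_hbr b v w : ev b (hbr v w) = - (dual 5 b * d5 v w + dual 6 b * d6 v w).
Proof.
rewrite evE !dual_hbr.
by rewrite !mulr0 !add0r !mulrN opprD.
Qed.

Lemma entry_ev v k : v 0 k = ev v (delta_mx 0 k).
Proof.
rewrite /ev (bigD1 k) //= mxE !eqxx mulr1 big1 ?addr0 // => j jk.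
by rewrite mxE (negPf jk) andbF mulr0.
Qed.

End Coordinates.

Section Concrete.
Variables (R : realType) (m n p : R).
Local Notation g := (gmnp R).
Local Notation F := (F_i m n p).
Local Notation al := (alpha m n p).
Local Notation gb := (gbr m n p).
Implicit Types (a b c : g) (u v w x y z : 'rV[R]_6).

Lemma gmnp_ext a b : a.1.1 = b.1.1 -> a.1.2 = b.1.2 -> a.2 = b.2 -> a = b.
Proof. by case: a b => [[? ?] ?] [[? ?] ?] /= -> -> ->. Qed.

Lemma subg3 a b k : (a - b).2 0 k = a.2 0 k - b.2 0 k.
Proof. by rewrite [(a - b).2](_ : _ = a.2 - b.2) // !mxE. Qed.

Lemma gbr1 a b : (gb a b).1.1 = hbr a.1.1 b.1.1.
Proof. by case: a b => [[? ?] ?] [[? ?] ?]. Qed.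
Lemma gbr2 a b : (gb a b).1.2 = - F a.1.1 b.1.1.
Proof. by case: a b => [[? ?] ?] [[? ?] ?]. Qed.
Lemma gbr3 a b k : let z := delta_mx 0 k in (gb a b).2 0 k =
  - ev b.2 (hbr a.1.1 z) + ev a.2 (hbr b.1.1 z) - dcomega a.1.1 b.1.1 z
  - 2 * al * (a.1.2 * F b.1.1 z - b.1.2 * F a.1.1 z).
Proof. by case: a b => [[? ?] ?] [[? ?] ?]; rewrite /= !mxE. Qed.

Lemma gbrC a b : gb a b = - gb b a.
Proof.
apply: gmnp_ext.
- rewrite gbr1 -[(- _).1.1]/(- (gb b a).1.1) gbr1; apply: row6P => i _.
  rewrite dualN /hbr !(dualN, dualD, dualZ) /d5 /d6 /dual2; ring.
- rewrite gbr2 -[(- _).1.2]/(- (gb b a).1.2) gbr2 /F_i /dual2; ring.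
- apply/rowP => k; rewrite -[(- _).2]/(- (gb b a).2) gbr3 mxE gbr3 /= /dcomega
  /dual3 /dual2; ring.
Qed.

Lemma gbr_linl b : linear (fun a => gb a b).
Proof.
move=> s a a'.
have e1 : (s *: a + a').1.1 = s *: a.1.1 + a'.1.1 by [].
have e2 : (s *: a + a').1.2 = s * a.1.2 + a'.1.2 by [].
have e3 : (s *: a + a').2 = s *: a.2 + a'.2 by [].
apply: gmnp_ext.
- rewrite -[RHS]/(s *: (gb a b).1.1 + (gb a' b).1.1) !gbr1 e1; apply: row6P => i _.
  rewrite /hbr !(dualN, dualD, dualZ) /d5 /d6 /dual2 !(dualD, dualZ); ring.
- rewrite -[RHS]/(s * (gb a b).1.2 + (gb a' b).1.2) !gbr2 e1 /F_i /dual2 !(dualD,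
  dualZ); ring.
- apply/rowP => k; rewrite -[_.2 in RHS]/(s *: (gb a b).2 + (gb a' b).2) !mxE !gbr3
  /=.
  move: (delta_mx 0 k) => z; rewrite -[s *: a.1.2]/(s * a.1.2).
  rewrite !ev_hbr /dcomega /F_i /dual3 /d5 /d6 /dual2 !(dualD, dualZ); ring.
Qed.

(* v - i I v and v + i I v are the components of 2 v in the eigenspaces of I. *)
Definition vec10 x : cplx g := (vplus x, vplus (- hI x)).
Definition vec01 x : cplx g := (vplus x, vplus (hI x)).

Lemma hIK x : hI (hI x) = - x.
Proof.
by apply: row6P => i; rewrite dualN; case: i => [|[|[|[|[|[|[|i]]]]]]] // _;
  rewrite !dual_hI.
Qed.

Lemma hIN x : hI (- x) = - hI x.
Proof. by apply/rowP => i; rewrite !mxE; case: ifP. Qed.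

Lemma Vplus10P (u : cplx g) : Vplus10 u <-> exists x, u = vec10 x.
Proof.
split=> [[[[x _ ux] [y _ uy]] E]|[x ->]].
  exists x; case: u ux uy E => u1 u2 /= <- <- [_ _ _] /= E _ _.
  have {}E : hI y = x by rewrite E scale0r add0r scale1r.
  by rewrite /vec10 -E hIK opprK.
split; first by split; [exists x | exists (- hI x)].
rewrite /cplx_map /= /Iplus /= hIN hIK opprK.
congr (_, _); rewrite ?scale0r ?scale1r ?add0r ?sub0r.
all: rewrite /vplus; congr (_, _, _); rewrite ?scale0r ?scale1r ?scaler0 ?add0r
  ?sub0r ?opprK /= ?oppr0 //.
Qed.

Lemma Vplus01P (u : cplx g) : Vplus01 u <-> exists x, u = vec01 x.
Proof.
split=> [[[[x _ ux] [y _ uy]] E]|[x ->]].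
  exists x; case: u ux uy E => u1 u2 /= <- <- [_ _ _] /= E _ _.
  have {}E : hI y = - x by rewrite E oppr0 scale0r add0r scaleN1r.
  by rewrite /vec01 -[x in hI x]opprK -E hIN hIK opprK.
split; first by split; [exists x | exists (hI x)].
rewrite /cplx_map /= /Iplus /= hIK.
congr (_, _); rewrite ?oppr0 ?scale0r ?scale1r ?add0r ?sub0r.
all: rewrite /vplus; congr (_, _, _); rewrite ?oppr0 ?scale0r ?scaleN1r ?scaler0
  ?add0r ?sub0r ?opprK /= ?oppr0 //.
all: by rewrite ?scale0r add0r.
Qed.

Local Notation B x y := (gb (vplus x) (vplus y)).

(** The vanishing of the Nijenhuis tensor: I is integrable. *)
Lemma hI_hbr x y : hI (hbr x y - hbr (hI x) (hI y)) = hbr (hI x) y + hbr x (hI y).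
Proof.
apply: row6P => i; case: i => [|[|[|[|[|[|[|i]]]]]]] // _.
all: rewrite dualD dual_hI !(dual_hbr, dualD, dualN) /d5 /d6 /dual2 ?dual_hI; ring.
Qed.

(** The real part of a bracket of two vectors of type (1,0) stays in V_+: its i R component vanishes
    because F is of type (1,1), and d^c omega makes the covector the metric dual of the vector. *)
Lemma gbr_type x y : B x y - B (hI x) (hI y) = vplus (hbr x y - hbr (hI x) (hI y)).
Proof.
apply: gmnp_ext.
- by rewrite -[LHS]/((gb _ _).1.1 - (gb _ _).1.1) !gbr1.
- rewrite -[LHS]/((gb _ _).1.2 - (gb _ _).1.2) !gbr2 /= /F_i /dual2 !dual_hI; ring.
- apply/rowP => k; rewrite subg3 !gbr3 /=.
  rewrite [RHS]entry_ev; move: (delta_mx 0 k) => z.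
  rewrite !ev_hbr evE !(dual_hbr, dualD, dualN).
  rewrite /dcomega /dual3 /d5 /d6 /dual2 !dual_hI; ring.
Qed.

Let BNl x y : B (- x) y = - B x y.
Proof.
rewrite -(linN (gbr_linl _)); congr (gb _ _).
by rewrite /vplus; congr (_, _, _); rewrite oppr0.
Qed.

Let BNr x y : B x (- y) = - B x y.
Proof. by rewrite gbrC BNl -gbrC. Qed.

Lemma gbr_type' x y :
  B x (hI y) + B (hI x) y = vplus (hI (hbr x y - hbr (hI x) (hI y))).
Proof.
have := gbr_type (hI x) y; rewrite hIK BNl opprK addrC => ->.
rewrite hI_hbr; congr vplus; congr (_ + _).
apply: row6P => i _; rewrite !dualN /hbr !(dualN, dualD, dualZ) /d5 /d6 /dual2
  !dualN; ring.
Qed.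

Lemma brk10 x y : exists z, cplx_brk gb (vec10 x) (vec10 y) = vec10 z.
Proof.
exists (hbr x y - hbr (hI x) (hI y)).
rewrite -[LHS]/((B x y - B (- hI x) (- hI y), B x (- hI y) + B (- hI x) y) : cplx g).
rewrite !BNl !BNr opprK -opprD gbr_type gbr_type'.
by rewrite /vec10 /vplus; congr (_, (_, _, _)); rewrite oppr0.
Qed.

Lemma brk01 x y : exists z, cplx_brk gb (vec01 x) (vec01 y) = vec01 z.
Proof.
exists (hbr x y - hbr (hI x) (hI y)).
rewrite -[LHS]/((B x y - B (hI x) (hI y), B x (hI y) + B (hI x) y) : cplx g).
by rewrite gbr_type gbr_type'.
Qed.

Lemma form_vplus x y : gform m n p (vplus x) (vplus y) = ev x y.
Proof.
rewrite /gform /= mulr0 mulr0 addr0 [ev y x](_ : _ = ev x y).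
  by field.
by apply: eq_bigr => k _; rewrite mulrC.
Qed.

Lemma ev_hI x y : ev (hI x) (hI y) = ev x y.
Proof. rewrite !evE !dual_hI; ring. Qed.

Lemma ev_hI' x y : ev (hI x) y = - ev x (hI y).
Proof. rewrite !evE !dual_hI; ring. Qed.

Lemma evNr x y : ev x (- y) = - ev x y.
Proof. rewrite !evE !dualN; ring. Qed.

Lemma evNl x y : ev (- x) y = - ev x y.
Proof. rewrite !evE !dualN; ring. Qed.

Local Notation form := (cplx_form (gform m n p)).

Lemma form10 x y : form (vec10 x) (vec10 y) = 0.
Proof.
rewrite /cplx_form -[(vec10 x).1]/(vplus x) -[(vec10 y).1]/(vplus y).
rewrite -[(vec10 x).2]/(vplus (- hI x)) -[(vec10 y).2]/(vplus (- hI y)).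
by rewrite !form_vplus !evNl !evNr ev_hI ev_hI' !opprK subrr addNr.
Qed.

Lemma form01 x y : form (vec01 x) (vec01 y) = 0.
Proof.
rewrite /cplx_form -[(vec01 x).1]/(vplus x) -[(vec01 y).1]/(vplus y).
rewrite -[(vec01 x).2]/(vplus (hI x)) -[(vec01 y).2]/(vplus (hI y)).
by rewrite !form_vplus ev_hI ev_hI' subrr addrN.
Qed.

Lemma form10_01 x y : form (vec10 x) (vec01 y) = Complex (ev x y *+ 2) (ev x (hI y)
  *+ 2).
Proof.
rewrite /cplx_form -[(vec10 x).1]/(vplus x) -[(vec01 y).1]/(vplus y).
rewrite -[(vec10 x).2]/(vplus (- hI x)) -[(vec01 y).2]/(vplus (hI y)).
by rewrite !form_vplus !evNl ev_hI ev_hI' !opprK !mulr2n.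
Qed.

Definition std10 (a : 'I_3) : cplx g := vec10 (delta_mx 0 (inord a.*2)).
(** The vectors v_1, v_3, v_5 have indices 0, 2, 4. The factor 1/2 compensates the factor 2 in
    [form10_01]. *)
Definition std01 (a : 'I_3) : cplx g := vec01 (2^-1 *: delta_mx 0 (inord a.*2)).

Lemma form_std i j : form (std10 i) (std01 j) = (i == j)%:R.
Proof.
have lt6 (c : 'I_3) : (c.*2 < 6)%N by rewrite (ltn_double c 3).
have ev1 : ev (delta_mx 0 (inord i.*2)) (2^-1 *: delta_mx 0 (inord j.*2)) *+ 2 =
    (i == j)%:R :> R.
  rewrite evE !dualZ !dual_delta // -val_eqE.
  by case: i => [[|[|[|i]]]] //= _; case: j => [[|[|[|j]]]] //= _; field.
have ev2 : ev (delta_mx 0 (inord i.*2)) (hI (2^-1 *: delta_mx 0 (inord j.*2))) = 0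
  :> R.
  rewrite evE !dual_hI !dualZ !dual_delta //.
  by case: i {ev1} => [[|[|[|i]]]] //= _; case: j => [[|[|[|j]]]] //= _; ring.
by rewrite form10_01 ev1 ev2 mul0rn; case: (i == j).
Qed.

(** The D-term: F is primitive, its values on (v_1, v_2) and (v_3, v_4) being opposite. The other
    components vanish because neither dv^5, dv^6 nor d^c omega has a term containing both members of
    a pair v^{12}, v^{34} or v^{56}. *)
Lemma sum_gbr_I :
  \sum_(i < 3) B (hI (delta_mx 0 (inord i.*2))) (delta_mx 0 (inord i.*2)) = 0.
Proof.
have E (i : 'I_3) : B (hI (delta_mx 0 (inord i.*2))) (delta_mx 0 (inord i.*2)) =
   (0, (if i == 0%N :> nat then - 1 else if i == 1%N :> nat then 1 else 0) * (2 *
     pi * m), 0).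
  have lt6 (c : 'I_3) : (c.*2 < 6)%N by rewrite (ltn_double c 3).
  apply: gmnp_ext.
  - rewrite gbr1 /= /hbr /d5 /d6 /dual2 !dual_hI !dual_delta //.
    case: i => [[|[|[|i]]]] //= _;
      by rewrite !(mulr0, mul0r, oppr0, subr0, addr0, scale0r, mulr1).
  - rewrite gbr2 /= /F_i /dual2 !dual_hI !dual_delta //.
    case: i => [[|[|[|i]]]] //= _; ring.
  - apply/rowP => k; rewrite gbr3 !ev_hbr [in RHS]mxE /dcomega /dual3 /d5 /d6
    /dual2 /= !dual_hI !dual_delta //.
    case: i => [[|[|[|i]]]] //= _; ring.
rewrite !big_ord_recl big_ord0 !E /=.
apply: gmnp_ext; rewrite /= ?addr0 //.
by rewrite mulN1r mul1r mul0r !addr0 addNr.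
Qed.

Lemma gbr_vplusZ s x y : B (s *: x) y = s *: B x y.
Proof.
rewrite -(linZ (gbr_linl _)); congr (gb _ _).
by rewrite /vplus; congr (_, _, _); rewrite scaler0.
Qed.

Lemma gbr_vplus_diag x : B x x = 0.
Proof.
have /eqP := gbrC (vplus x) (vplus x).
by rewrite -addr_eq0 -mulr2n -scaler_nat scaler_eq0 pnatr_eq0 => /eqP.
Qed.

Lemma hIZ s x : hI (s *: x) = s *: hI x.
Proof. by apply/rowP => i; rewrite !mxE; case: ifP => _; rewrite ?mulrN. Qed.

Lemma sum_brk_std : \sum_i cplx_brk gb (std01 i) (std10 i) = 0.
Proof.
have E i : cplx_brk gb (std01 i) (std10 i) =
    (0, B (hI (delta_mx 0 (inord i.*2))) (delta_mx 0 (inord i.*2))).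
  rewrite /std01 /std10; set x := delta_mx 0 _.
  rewrite -[LHS]/((B (2^-1 *: x) x - B (hI (2^-1 *: x)) (- hI x),
     B (2^-1 *: x) (- hI x) + B (hI (2^-1 *: x)) x) : cplx g).
  rewrite hIZ !gbr_vplusZ !BNr !gbr_vplus_diag oppr0 !scaler0 subrr.
  congr (_, _); rewrite -gbrC -scalerDr -mulr2n -scaler_nat scalerA mulVf ?scale1r //.
  by rewrite pnatr_eq0.
under eq_bigr do rewrite E.
have := sum_gbr_I; rewrite !big_ord_recl !big_ord0 => E0.
rewrite -[LHS]/((0 + (0 + (0 + 0)),  B (hI 'e_(inord (ord0 : 'I_3).*2)) 'e_(inord
  (ord0 : 'I_3).*2)
  + (B (hI 'e_(inord (lift ord0 (ord0 : 'I_2)).*2)) 'e_(inord (lift ord0 (ord0 :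
    'I_2)).*2)
  + (B (hI 'e_(inord (lift ord0 (lift ord0 (ord0 : 'I_1))).*2)) 'e_(inord (lift
    ord0 (lift ord0 (ord0 : 'I_1))).*2) + 0))) : cplx g).
by rewrite E0 !addr0.
Qed.

Lemma ev_eq0 w : (forall z, ev z w = 0) -> w = 0.
Proof.
move=> w0; apply/rowP => k; rewrite entry_ev mxE -[RHS](w0 (delta_mx 0 k)).
by apply: eq_bigr => i _; rewrite mulrC.
Qed.

(** [proj] selects some component, so every decomposition 0 = a + b + c has to be excluded unless a
    = 0. Pairing with V_+ removes c, and the metric, being nondegenerate, gives b = - a. *)
Lemma proj_0 (A C : set (cplx g)) :
  (forall a : cplx g, A a -> exists x x', a = (vplus x, vplus x')) ->
  (forall a : cplx g, C a -> exists x x', a = (vplus x, vplus x')) ->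
  (forall a : cplx g, A a -> C (- a) -> a = 0) ->
  proj m n p A C 0 = 0.
Proof.
move=> hA hC AC; rewrite /proj; case: xgetP => [a _ [Aa [b [c [Cb [V1 V2] E]]]]|//].
apply: AC => //; suff <- : b = - a by [].
have [x [x' Ea]] := hA _ Aa; have [y [y' Eb]] := hC _ Cb.
have perp (c1 : g) x1 y1 : Vminus m n p c1 -> 0 = vplus x1 + vplus y1 + c1 -> y1 =
  - x1.
  move=> Vc /esym/eqP; rewrite addrC addr_eq0 => /eqP Ec.
  apply/eqP; rewrite -addr_eq0 addrC; apply/eqP/ev_eq0 => z.
  have := Vc (vplus z) (ex_intro2 _ _ z I erefl).
  have -> : c1 = vplus (- (x1 + y1)).
    by rewrite Ec /vplus; congr (_, _, _); rewrite /= addr0 oppr0.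
  by rewrite form_vplus evNr => /eqP; rewrite oppr_eq0 => /eqP.
case: c V1 V2 E => c1 c2 /= V1 V2; rewrite Ea Eb => E.
rewrite (perp _ x y V1 (congr1 fst E)) (perp _ x' y' V2 (congr1 snd E)).
by rewrite /vplus; congr ((_, _, _), (_, _, _)); rewrite /= oppr0.
Qed.

Lemma vec10_01_disjoint (a : cplx g) : Vplus10 a -> Vplus01 (- a) -> a = 0.
Proof.
move=> /Vplus10P[x ->] /Vplus01P[w [wx _ _ hw _ _]].
have /(congr1 (@hI R)) : hI x = hI w by rewrite -hw opprK.
rewrite !hIK => /oppr_inj xw.
have x0 : x = 0.
  apply/eqP; move/eqP: wx; rewrite xw eq_sym -addr_eq0 -mulr2n -scaler_nat.
  by rewrite scaler_eq0 pnatr_eq0 /=.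
rewrite x0 /vec10 /vplus /=; congr (_, (_, _, _)); apply/rowP => i; rewrite !mxE;
by case: ifP; rewrite ?oppr0.
Qed.

(** * Arbitrary dual bases of V_+^{1,0} and V_+^{0,1} *)

Section Bases.
Variables (k : R[i]) (V : susyVA R[i]) (Pi : cplx g -> V) (eps epsb : 'I_3 -> cplx g).
Local Notation brk := (cplx_brk gb).
Hypotheses (hPi : superaffine_map brk form k Pi) (hk : k != 0) (hvac : vac V != 0).
Hypotheses (heps : basis3 (@Vplus10 R) eps) (hepsb : basis3 (@Vplus01 R) epsb).
Hypothesis hdual : forall i j, form (eps i) (epsb j) = (i == j)%:R.

Lemma expand10 (u : cplx g) : Vplus10 u -> u = proj_on form eps epsb u.
Proof.
move=> /(heps.2 u)[x [ux _]]; rewrite {1}ux; apply: eq_bigr => j _; congr (_ *: _).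
rewrite ux (form_suml hPi hk hvac) (bigD1 j) //= (formZl hPi hk hvac) hdual eqxx
  mulr1.
rewrite big1 ?addr0 // => i ij; rewrite (formZl hPi hk hvac) hdual (negPf ij).
by rewrite mulr0.
Qed.

Lemma expand01 (u : cplx g) : Vplus01 u -> u = proj_on form epsb eps u.
Proof.
move=> /(hepsb.2 u)[x [ux _]]; rewrite {1}ux; apply: eq_bigr => j _; congr (_ *: _).
rewrite ux (form_suml hPi hk hvac) (bigD1 j) //= (formZl hPi hk hvac).
rewrite (formC hPi hk hvac) hdual eqxx mulr1.
rewrite big1 ?addr0 // => i ij; rewrite (formZl hPi hk hvac) (formC hPi hk hvac)
  hdual.
by rewrite eq_sym (negPf ij) mulr0.
Qed.

(** The tensor sum_j e^j (x) e_j does not depend on the dual bases, so the standard ones suffice.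
    Duality makes the two transition matrices inverse to each other on one side, hence on both. *)
Lemma sum_brk_dual : \sum_j brk (epsb j) (eps j) = 0.
Proof.
have h10 i : Vplus10 (std10 i) by apply/Vplus10P; eexists.
have h01 i : Vplus01 (std01 i) by apply/Vplus01P; eexists.
pose M : 'M_3 := \matrix_(a, j) form (std10 a) (epsb j).
pose M' : 'M_3 := \matrix_(j, a) form (std01 a) (eps j).
have MM' : M *m M' = 1%:M.
  apply/matrixP => a b; rewrite !mxE -form_std [in RHS](expand01 (h01 b)).
  rewrite /proj_on (form_sumr hPi hk hvac); apply: eq_bigr => j _.
  by rewrite !mxE (formZr hPi hk hvac) mulrC.
have M'M : M' *m M = 1%:M by apply: mulmx1C.
rewrite -[RHS]sum_brk_std.
have ll := cplx_brk_linl gbr_linl; have lr := cplx_brk_linr gbr_linl gbrC.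
transitivity (\sum_i \sum_j (M' *m M) i j *: brk (epsb i) (eps j)).
  apply: eq_bigr => i _; rewrite M'M (bigD1 i) //= mxE eqxx scale1r big1 ?addr0 //.
  by move=> j ji; rewrite mxE eq_sym (negPf ji) scale0r.
under [RHS]eq_bigr => a _.
  rewrite {1}(expand01 (h01 a)) (expand10 (h10 a)) /proj_on (lin_sum (ll _)).
  under eq_bigr do rewrite (lin_sum (lr _)).
  over.
rewrite [RHS]exchange_big; apply: eq_bigr => i _.
rewrite exchange_big; apply: eq_bigr => j _.
rewrite mxE scaler_suml; apply: eq_bigr => a _.
by rewrite !mxE (linZ (ll _)) (linZ (lr _)) scalerA.
Qed.

Lemma polarization_dual : polarization brk form Pi eps epsb.
Proof.
have in10 i := heps.1 i; have in01 i := hepsb.1 i.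
split.
- by move=> i j; have [/Vplus10P[x ->] /Vplus10P[y ->]] := (in10 i, in10 j); exact:
  form10.
- by move=> i j; have [/Vplus01P[x ->] /Vplus01P[y ->]] := (in01 i, in01 j); exact:
  form01.
- exact: hdual.
- move=> i j; congr Pi; apply: expand10.
  have [/Vplus10P[x ->] /Vplus10P[y ->]] := (in10 i, in10 j).
  by have [z ->] := brk10 x y; apply/Vplus10P; exists z.
- move=> i j; congr Pi; apply: expand01.
  have [/Vplus01P[x ->] /Vplus01P[y ->]] := (in01 i, in01 j).
  by have [z ->] := brk01 x y; apply/Vplus01P; exists z.
- by rewrite -(Pi_sum hPi) sum_brk_dual (Pi0 hPi).
Qed.

Lemma w_eq0 : w_ m n p eps epsb = 0.
Proof.
have p10 (a : cplx g) : Vplus10 a -> exists x x', a = (vplus x, vplus x').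
  by move=> /Vplus10P[x ->]; exists x, (- hI x).
have p01 (a : cplx g) : Vplus01 a -> exists x x', a = (vplus x, vplus x').
  by move=> /Vplus01P[x ->]; exists x, (hI x).
have d01 (a : cplx g) : Vplus01 a -> Vplus10 (- a) -> a = 0.
  by move=> A1 A2; apply/oppr_inj; rewrite oppr0; apply: vec10_01_disjoint; rewrite
    ?opprK.
by rewrite /w_ sum_brk_dual (proj_0 p10 p01 vec10_01_disjoint) (proj_0 p01 p10 d01)
  subrr.
Qed.

End Bases.

End Concrete.

Theorem proposition5p6 (R : realType) (m n p : R) (k : R[i])
    (V : susyVA R[i]) (Pi : cplx (gmnp R) -> V)
    (eps epsb : 'I_3 -> cplx (gmnp R))
    (hmnp : (m, n, p) != (0, 0, 0)) (hk : k != 0)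
    (hV : universal_superaffine (cplx_brk (gbr m n p))
            (cplx_form (gform m n p)) k Pi)
    (heps : basis3 (@Vplus10 R) eps) (hepsb : basis3 (@Vplus01 R) epsb)
    (hdual : forall j r,
       cplx_form (gform m n p) (eps j) (epsb r) = (j == r)%:R) :
  induces_N2_embedding 9 (J0 k Pi eps epsb) (H' m n p k Pi eps epsb).
Proof.
suff N2 : N2_pair 9 (J0 k Pi eps epsb) (H' m n p k Pi eps epsb).
  by split=> // charge JN HN [_]; apply.
have [hPi _] := hV.
(* A zero vacuum forces every a = :vac a: to be 0; otherwise [form] can be read off V. *)
have [vac0|vac0] := eqVneq (vac V) 0.
  have V0 (a : V) : a = 0 by rewrite -[a]nop_vacl vac0 nop0l.
  split; rewrite ?[J0 _ _ _ _]V0 ?[H' _ _ _ _ _ _ _]V0; try exact: homog0.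
  by split; apply/funext => i; apply/funext => q; rewrite [LHS]V0 [RHS]V0.
have pol := polarization_dual hPi hk vac0 heps hepsb hdual.
(* The second factor is the dimension d = 3 of l. *)
have -> : 9 = 3 * 3%:R :> R[i] by rewrite -natrM.
have -> : H' m n p k Pi eps epsb = k ^- 2 *: omega_omega Pi eps epsb.
  rewrite /H' (w_eq0 hPi hk vac0 heps hepsb hdual) (Pi0 hPi) /opTV !opSV0.
  rewrite scaler0 addr0 (omega_omega_explicit hPi hk vac0 pol) scalerDr scalerA.
  by rewrite expr2 invfM -mulrA mulVf // mulr1.
exact: (N2_pair_polarization hPi hk vac0 pol (sqrCi _)).
Qed.
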